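(* Let $m$ be a positive integer with $km\equiv -k\pmod{12}$. Then one can define two Hecke operators $$T^{v}_{m,k}:\mathcal{M}(\Gamma,v,k,R)\to\mathcal{M}(\Gamma,\overline v,k,R),\qquad T^{\overline v}_{m,k}:\mathcal{M}(\Gamma,\overline v,k,R)\to\mathcal{M}(\Gamma,v,k,R)$$ which act on Fourier expansions as follows. If $f\in\mathcal{M}(\Gamma,v,k,R)$ and $g\in\mathcal{M}(\Gamma,\overline v,k,R)$ have Fourier expansions $f=\sum_n c(n)\mathcal{W}_{n,k,R}$ and $g=\sum_n c'(n)\mathcal{W}^{*}_{n,k,R}$, then $$T^{v}_{m,k}f(z)=\sum_{n=-\infty}^{\infty}d(n)\mathcal{W}^{*}_{n,k,R}(z),\qquad T^{\overline v}_{m,k}g(z)=\sum_{n=-\infty}^{\infty}b(n)\mathcal{W}_{n,k,R}(z),$$ where $$d(n)=\sum_{0<a\mid\left(m,\;n-\frac{k(m+1)}{12}\right)}\chi_k(a)\,c\left(\frac{mn}{a^2}-\frac{k(m+a^2)}{12a^2}\right),$$ $$b(n)=\sum_{0<a\mid\left(m,\;n+\frac{k(m+1)}{12}\right)}\chi_k(a)\,c'\left(\frac{mn}{a^2}+\frac{k(m+a^2)}{12a^2}\right).$$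
   Context: Let $\mathcal{H}$ be the upper half-plane, $\overline{\Gamma}=SL(2,\mathbb{Z})$, $\Gamma=PSL(2,\mathbb{Z})$, $e(z)=e^{2\pi i z}$; $(a,b)$ denotes the greatest common divisor, with $(a,0)=a$; $\mathrm{Arg}$ takes values in $]-\pi,\pi]$. Fix an integer $k$ with $1\le k\le 11$ and put $\chi_k(d)=i^{k(d-1)}$ for integers $d$. Let $v=v_\eta^{2k}:\overline{\Gamma}\to S^1$ be the weight $k$ multiplier system of $\eta^{2k}$, i.e. $\eta(gz)^{2k}=v(g)(cz+d)^k\eta(z)^{2k}$ for $g=\begin{pmatrix}a&b\\c&d\end{pmatrix}\in\overline{\Gamma}$, where $\eta(z)=e(z/24)\prod_{n\ge1}(1-e(nz))$; in particular $v\begin{pmatrix}1&1\\0&1\end{pmatrix}=e(k/12)$. $\overline v$ is the complex conjugate of $v$. Fix a real $R$ with $\lambda=\frac14+R^2>\frac14$. For $w\in\{v,\overline v\}$, $\mathcal{M}(\Gamma,w,k,R)$ is the space of Maass waveforms: functions $f$ on $\mathcal{H}$ with $f(gz)=w(g)\,e^{ik\mathrm{Arg}(cz+d)}f(z)$ for all $g=\begin{pmatrix}a&b\\c&d\end{pmatrix}\in\overline{\Gamma}$, with $(\Delta_k+\lambda)f=0$, where $\Delta_k=y^2\left(\frac{\partial^2}{\partial x^2}+\frac{\partial^2}{\partial y^2}\right)-iky\frac{\partial}{\partial x}$, and with $\int_{\Gamma\backslash\mathcal{H}}|f|^2\frac{dx\,dy}{y^2}<\infty$. Elements of $\mathcal{M}(\Gamma,v,k,R)$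 have Fourier expansions $\sum_{n\in\mathbb{Z}}c(n)\mathcal{W}_{n,k,R}(z)$ and elements of $\mathcal{M}(\Gamma,\overline v,k,R)$ have Fourier expansions $\sum_{n\in\mathbb{Z}}c'(n)\mathcal{W}^*_{n,k,R}(z)$, where, for $z=x+iy$ and $\alpha_k=\frac{k}{12}$, $$\mathcal{W}_{n,k,R}(z)=\frac{W_{\frac k2\mathrm{sgn}(n+\alpha_k),\,iR}\left(4\pi|n+\alpha_k|y\right)}{\sqrt{|n+\alpha_k|}}e\left((n+\alpha_k)x\right),\quad \mathcal{W}^*_{n,k,R}(z)=\frac{W_{\frac k2\mathrm{sgn}(n-\alpha_k),\,iR}\left(4\pi|n-\alpha_k|y\right)}{\sqrt{|n-\alpha_k|}}e\left((n-\alpha_k)x\right)$$ and $W_{l,\mu}$ is the Whittaker $W$-function. *)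

(* Defs.v *)
From HB Require Import structures.
From mathcomp Require Import all_boot all_order all_algebra.
From mathcomp Require Import complex.
From mathcomp Require Import all_classical all_reals all_analysis.

Set Implicit Arguments.
Unset Strict Implicit.
Unset Printing Implicit Defensive.

Import Order.TTheory GRing.Theory Num.Theory.
Import numFieldNormedType.Exports.

Local Open Scope complex_scope.
Local Open Scope classical_set_scope.
Local Open Scope ring_scope.

(* The usual topology of the complex plane, inherited from the norm of the
   numFieldType R[i]. *)
#[warnings="-redundant-canonical-projection"]
HB.instance Definition _ (R : realType) := NormedModule.copy R[i] R[i]^o.

Section Complex.
Variable R : realType.
Implicit Types (x y : R) (z s : R[i]).

Definition cabs z : R := complex.Re `|z|.

Definition cexp z : R[i] :=
  (expR (complex.Re z))%:C * (cos (complex.Im z) +i* sin (complex.Im z)).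

(* e(z) = exp (2 pi i z) *)
Definition e2pi z : R[i] := cexp ((2 * pi)%:C * 'i * z).

(* Principal argument, with values in ]-pi, pi], for z != 0. *)
Definition Arg z : R :=
  let t := acos (complex.Re z / cabs z) in
  if 0 <= complex.Im z then t else - t.

(* y ^ s for y > 0 *)
Definition cpow y s : R[i] := cexp (s * (ln y)%:C).

(* Gauss's formula, valid for every z that is not a pole. *)
Definition Gamma z : R[i] :=
  limn (fun n : nat =>
    n`!%:R * cpow n%:R z / \prod_(0 <= j < n.+1) (z + j%:R)).

Definition pochhammer z (n : nat) : R[i] := \prod_(0 <= j < n) (z + j%:R).

Definition whittakerM (l mu : R[i]) y : R[i] :=
  cexp (- (y / 2)%:C) * cpow y (2^-1 + mu) *
  limn (series (fun n : nat =>
    pochhammer (2^-1 + mu - l) n / (pochhammer (1 + 2 * mu) n * n`!%:R)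
    * y%:C ^+ n)).

(* W_{l,mu}(y) for y > 0 and 2 mu not an integer (Gradshteyn-Ryzhik 9.220.4,
   DLMF 13.14.33); it is only used with mu = i r, r real and nonzero. *)
Definition whittakerW (l mu : R[i]) y : R[i] :=
  Gamma (- (2 * mu)) / Gamma (2^-1 - mu - l) * whittakerM l mu y +
  Gamma (2 * mu) / Gamma (2^-1 + mu - l) * whittakerM l (- mu) y.

End Complex.

Section UpperHalfPlane.
Variable R : realType.
(* Functions on the upper half-plane are represented by functions on R[i] whose
   values outside of it are irrelevant. *)
Implicit Types (f : R[i] -> R[i]) (z : R[i]) (g : 'M[int]_2).

Definition uhp : set R[i] := [set z | 0 < complex.Im z].

Definition denom g z : R[i] := (g 1 0)%:~R * z + (g 1 1)%:~R.

Definition mobius g z : R[i] := ((g 0 0)%:~R * z + (g 0 1)%:~R) / denom g z.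

Definition eta z : R[i] :=
  e2pi (z / 24) *
  limn (fun N : nat => \prod_(1 <= n < N.+1) (1 - e2pi (n%:R * z))).

(* v is the weight k multiplier system of eta ^ (2k); only its values on
   SL(2,Z) matter, and these are determined since eta does not vanish. *)
Definition eta_multiplier (k : nat) (v : 'M[int]_2 -> R[i]) : Prop :=
  forall g, \det g = 1 ->
    `|v g| = 1 /\
    forall z, uhp z ->
      eta (mobius g z) ^+ (2 * k) = v g * denom g z ^+ k * eta z ^+ (2 * k).

(* Partial derivatives of a complex-valued function of z = x + i y are taken
   componentwise in the real and imaginary parts of the value. *)
Definition partial_x f z : R[i] :=
  derive1 (fun t : R => complex.Re (f (t +i* complex.Im z))) (complex.Re z) +i*
  derive1 (fun t : R => complex.Im (f (t +i* complex.Im z))) (complex.Re z).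

Definition partial_y f z : R[i] :=
  derive1 (fun t : R => complex.Re (f (complex.Re z +i* t))) (complex.Im z) +i*
  derive1 (fun t : R => complex.Im (f (complex.Re z +i* t))) (complex.Im z).

Definition has_partials f z : Prop :=
  [/\ derivable (fun t : R => complex.Re (f (t +i* complex.Im z)))
        (complex.Re z) 1,
      derivable (fun t : R => complex.Im (f (t +i* complex.Im z)))
        (complex.Re z) 1,
      derivable (fun t : R => complex.Re (f (complex.Re z +i* t)))
        (complex.Im z) 1 &
      derivable (fun t : R => complex.Im (f (complex.Re z +i* t)))
        (complex.Im z) 1].

(* f is of class C^n on the upper half-plane, in the sense of real variables *)
Fixpoint classC (n : nat) f : Prop :=
  (forall z, uhp z -> {for z, continuous f}) /\
  (if n is n'.+1 then
     [/\ forall z, uhp z -> has_partials f z,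
         classC n' (partial_x f) & classC n' (partial_y f)]
   else True).

Definition laplacian (k : nat) f z : R[i] :=
  (complex.Im z ^+ 2)%:C *
    (partial_x (partial_x f) z + partial_y (partial_y f) z)
  - 'i * k%:R * (complex.Im z)%:C * partial_x f z.

(* The standard fundamental domain of PSL(2,Z), in the coordinates (x, y). *)
Definition fundamental_domain : set (R * R) :=
  [set p | [/\ 0 < p.2, `|p.1| <= 2^-1 & 1 <= p.1 ^+ 2 + p.2 ^+ 2]].

Definition square_integrable f : Prop :=
  (\int[@lebesgue_measure R \x @lebesgue_measure R]_(p in fundamental_domain)
     (cabs (f (p.1 +i* p.2)) ^+ 2 / p.2 ^+ 2)%:E < +oo)%E.

Definition maass_waveform (w : 'M[int]_2 -> R[i]) (k : nat) (r : R)
    : set (R[i] -> R[i]) :=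
  [set f | [/\ classC 2 f,
    forall g z, \det g = 1 -> uhp z ->
      f (mobius g z) = w g * cexp ('i * k%:R * (Arg (denom g z))%:C) * f z,
    forall z, uhp z -> laplacian k f z + (4^-1 + r ^+ 2)%:C * f z = 0 &
    square_integrable f]].

End UpperHalfPlane.

Section Fourier.
Variable R : realType.
Implicit Types (c : int -> R[i]) (f : R[i] -> R[i]).

(* The series of the u n, n in Z, converges absolutely with sum s. *)
Definition sums_to (u : int -> R[i]) (s : R[i]) : Prop :=
  (\esum_(n in [set: int]) (cabs (u n))%:E < +oo)%E /\
  (fun N : nat => \sum_(0 <= j < N.*2.+1) u (j%:Z - N%:Z)) @ \oo --> s.

Definition fourier_term (k : nat) (r beta : R) (z : R[i]) : R[i] :=
  whittakerW (k%:R / 2 * Num.sg beta)%:C ('i * r%:C)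
    (4 * pi * `|beta| * complex.Im z)
  / (Num.sqrt `|beta|)%:C * e2pi (beta * complex.Re z)%:C.

Definition Wfun (k : nat) (r : R) (n : int) : R[i] -> R[i] :=
  fourier_term k r (n%:~R + k%:R / 12).

Definition Wstar (k : nat) (r : R) (n : int) : R[i] -> R[i] :=
  fourier_term k r (n%:~R - k%:R / 12).

Definition fourier_expansion (W : int -> R[i] -> R[i]) c f : Prop :=
  forall z, uhp z -> sums_to (fun n => c n * W n z) (f z).

Definition chi (k : nat) (d : int) : R[i] := 'i ^ (k%:Z * (d - 1)).

(* When k m = - k mod 12, the division by 12 is exact, and so is the division
   by 12 a^2 for every a in the range of summation: the index of c is the
   integer m n / a^2 - k (m + a^2) / (12 a^2), resp. with + for hecke_b. *)
Definition hecke_d (k m : nat) c (n : int) : R[i] :=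
  \sum_(1 <= a < m.+1 |
      (a%:Z %| gcdz m%:Z (n - ((k * (m + 1)) %/ 12)%N%:Z))%Z)
    chi k a%:Z *
    c ((12 * m%:Z * n - (k * (m + a ^ 2))%N%:Z) %/ (12 * a ^ 2)%N%:Z)%Z.

Definition hecke_b (k m : nat) c (n : int) : R[i] :=
  \sum_(1 <= a < m.+1 |
      (a%:Z %| gcdz m%:Z (n + ((k * (m + 1)) %/ 12)%N%:Z))%Z)
    chi k a%:Z *
    c ((12 * m%:Z * n + (k * (m + a ^ 2))%N%:Z) %/ (12 * a ^ 2)%N%:Z)%Z.

(* T is a weighted sum over Hecke's representatives [a, b; 0, d], ad = m,
   0 <= b < d, of the integral matrices of determinant m modulo SL(2,Z); no
   factor e^{-ik Arg} appears because d > 0. *)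
Definition hecke_operator (m : nat)
    (T : (R[i] -> R[i]) -> (R[i] -> R[i])) : Prop :=
  exists w : nat -> nat -> R[i], forall f z, uhp z ->
    T f z =
    \sum_(1 <= a < m.+1 | (a %| m)%N) \sum_(0 <= b < (m %/ a)%N)
      w a b * f ((a%:R * z + b%:R) / (m %/ a)%N%:R).

End Fourier.

(* Main.v *)
Require Import Defs.
From HB Require Import structures.
From mathcomp Require Import all_boot all_order all_algebra.
From mathcomp Require Import complex zify ring lra.
From mathcomp Require Import all_classical all_reals all_analysis.
From mathcomp Require Import measurable_realfun.

(** For u = v or its conjugate, put kap = k or - k.  The operator sends f to
    m^(-1/2) * sum over a d = m, 0 <= b < d of
      i^(kap (a - 1)) e(- kap b d / 12) f((a z + b) / d).
    The series of eta at z = i does not vanish, so u is a character of SL2(Z)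
    with u(T) = e(kap / 12) and u(S) = u(T)^(-3).  The classical congruence
    formula for this character extends its inverse to integral matrices of
    determinant m = -1 mod 12 / gcd(kap, 12), by means of
    M |-> M diag(1, -1); the extension W satisfies W(g M) = u(g)^(-1) W(M)
    and W(M g) = u(g) W(M), and its values at [a, b; 0, d] are the weights
    above.  Writing [a, b; 0, d] g = g' [a', b'; 0, d'] then turns the weight k
    transformation law of f under g' into that of the image under g with u
    replaced by its inverse: the two automorphy factors have the same argument
    because d and d' are positive.

    Smoothness and the eigenvalue equation are invariant under the maps
    z |-> al z + be, al > 0.  Such a map sends the fundamental domain into a
    half-strip |x| <= X, y >= c with c > 0, over which f is square integrable:
    by continuity on the compact part y <= 1, by periodicity of |f| above.

    In the Fourier expansion, the sum over b is a sum of roots of unity which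
    selects the n with d | n - kap (d^2 - 1) / 12; the absolute convergence
    allows reindexing by n |-> a (n + kap / 12) / d + kap / 12. *)

Set Implicit Arguments.
Unset Strict Implicit.
Unset Printing Implicit Defensive.

Import Order.TTheory GRing.Theory Num.Theory.
Import numFieldNormedType.Exports.
Local Open Scope complex_scope.
Local Open Scope classical_set_scope.
Local Open Scope ring_scope.

(** * Congruences modulo 12 and integral matrices *)

(** Moves divisibility into the finite ring ['Z_p], where polynomial congruences can be decided by
    enumeration. *)
Lemma dvdz_Zp (p : nat) (x : int) : (1 < p)%N ->
  (p%:Z %| x)%Z = (x%:~R == 0 :> 'Z_p).
Proof.
move=> p1; have nat_case (n : nat) : (p%:Z %| n%:Z)%Z = (n%:R == 0 :> 'Z_p).
  by rewrite dvdzE /= -val_eqE /= val_Zp_nat.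
case: x => n; first exact: nat_case.
by rewrite NegzE dvdzE abszN -dvdzE rmorphN oppr_eq0 nat_case.
Qed.

(** The residues are listed through [iota] so that the exhaustive test evaluates under
    [vm_compute]. *)
Definition all4 (p : nat) (P : 'Z_p -> 'Z_p -> 'Z_p -> 'Z_p -> bool) :=
  let s := map (@inZp (Zp_trunc p).+1) (iota 0 p) in
  all (fun a => all (fun b => all (fun c => all (P a b c) s) s) s) s.

Lemma all4P (p : nat) (P : 'Z_p -> 'Z_p -> 'Z_p -> 'Z_p -> bool) :
  (1 < p)%N -> all4 P -> forall a b c d, P a b c d.
Proof.
move=> p1 + a b c d.
have mem (x : 'Z_p) : x \in map (@inZp (Zp_trunc p).+1) (iota 0 p).
  apply/mapP; exists (val x); last by rewrite valZpK.
  by rewrite mem_iota /= add0n -[X in (_ < X)%N](Zp_cast p1) ltn_ord.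
by move=> /allP/(_ a (mem a))/allP/(_ b (mem b))/allP/(_ c (mem c))/allP/(_ d (mem d)).
Qed.

Lemma all2P (p : nat) (P : 'Z_p -> 'Z_p -> bool) :
  (1 < p)%N -> all4 (fun a b _ _ => P a b) -> forall a b, P a b.
Proof. by move=> p1 /(all4P p1) h a b; exact: h a b 0 0. Qed.

(* The hypothesis on D amounts to 12 / gcd(kap, 12) | D. *)
Lemma dvdz12_mul (kap D X : int) : (12 %| kap * D)%Z ->
  ((2 %| D)%Z -> (2 %| X)%Z) -> ((3 %| D)%Z -> (3 %| X)%Z) ->
  ((4 %| D)%Z -> (4 %| X)%Z) -> (12 %| kap * X)%Z.
Proof.
move=> h12 h2 h3 h4.
have d3 : (3 %| kap * X)%Z.
  have : (3 %| kap * D)%Z by apply: dvdz_trans h12.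
  have p3 : prime 3 by [].
  have e3 x y : (3 %| x * y)%Z = (3 %| x)%Z || (3 %| y)%Z.
    by rewrite !dvdzE abszM (Euclid_dvdM _ _ p3).
  by rewrite !e3 => /orP[->//|/h3 ->]; rewrite orbT.
(* Only the residue r of kap modulo 4 matters: an odd r transfers divisibility by 4 from D to X, r =
   2 transfers divisibility by 2, and r = 0 leaves nothing to prove. *)
have d4 : (4 %| kap * X)%Z.
  have : (4 %| kap * D)%Z by apply: dvdz_trans h12.
  pose q := (kap %/ 4)%Z; pose r := (kap %% 4)%Z.
  have er x : (4 %| kap * x)%Z = (4 %| r * x)%Z.
    have -> : kap * x = 4 * (q * x) + r * x by rewrite (divz_eq kap 4) -/q -/r; ring.
    by lia.
  rewrite !er; have : r = 0 \/ r = 1 \/ r = 2 \/ r = 3.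
    by have := modz_ge0 kap (isT : 4 != 0 :> int); have := ltz_mod kap (isT : 4 != 0 :> int); rewrite -/r; lia.
  have e2 x : (4 %| 2 * x)%Z = (2 %| x)%Z by lia.
  have e3 x : (4 %| 3 * x)%Z = (4 %| x)%Z by lia.
  case=> [->|[->|[->|->]]]; rewrite ?mul0r ?mul1r ?e2 ?e3 => h //.
  - exact: h4.
  - exact: h2.
  - exact: h4.
have e12 x : (12 %| x)%Z = (3 %| x)%Z && (4 %| x)%Z by lia.
by rewrite e12 d3.
Qed.

(* The multiplier of eta ^ 2 at [a, b; c, d] is e(phi a b c d / 12). *)
Definition phi (R : pzRingType) (a b c d : R) : R :=
  (1 - c ^+ 2) * (b * d + 3%:R * (c - 1) * d + c + 3%:R) + c * (a + d - 3%:R).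

Definition mx2 (R : Type) (a b c d : R) : 'M[R]_2 :=
  \matrix_(i < 2, j < 2) if i == 0 then (if j == 0 then a else b)
                         else (if j == 0 then c else d).

(** * Generators of SL(2,Z) and Hermite normal forms *)

Section Matrices.
Implicit Types g h M : 'M[int]_2.

Lemma mx2_eta (R : Type) (g : 'M[R]_2) : g = mx2 (g 0 0) (g 0 1) (g 1 0) (g 1 1).
Proof.
apply/matrixP => i j; rewrite mxE.
by case: i => [[|[|//]] ?]; case: j => [[|[|//]] ?] /=; congr (g _ _); apply: val_inj.
Qed.

Lemma mul_mx2 (R : pzSemiRingType) (a b c d a' b' c' d' : R) :
  mx2 a b c d *m mx2 a' b' c' d' =
  mx2 (a * a' + b * c') (a * b' + b * d') (c * a' + d * c') (c * b' + d * d').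
Proof.
apply/matrixP => i j; rewrite !mxE !big_ord_recl big_ord0 !mxE /= addr0.
by case: i => [[|[|//]] ?]; case: j => [[|[|//]] ?].
Qed.

Lemma det_mx2 (R : comPzRingType) (a b c d : R) : \det (mx2 a b c d) = a * d - b * c.
Proof.
rewrite (expand_det_row _ 0) !big_ord_recl big_ord0 addr0 /cofactor !det_mx11.
by rewrite !mxE /=; ring.
Qed.

Lemma one_mx2 (R : pzSemiRingType) : 1%:M = mx2 1 0 0 1 :> 'M[R]_2.
Proof.
apply/matrixP => i j; rewrite !mxE.
by case: i => [[|[|//]] ?]; case: j => [[|[|//]] ?].
Qed.

Definition Smx : 'M[int]_2 := mx2 0 (-1) 1 0.
Definition Tmx : 'M[int]_2 := mx2 1 1 0 1.

Lemma det1_unit g : \det g = 1 -> g \in unitmx.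
Proof. by move=> g1; rewrite unitmxE g1 unitr1. Qed.

Lemma det1_inv g : \det g = 1 -> \det (invmx g) = 1.
Proof. by move=> g1; rewrite det_inv g1 invr1. Qed.

Lemma det1_mul g h : \det g = 1 -> \det h = 1 -> \det (g *m h) = 1.
Proof. by move=> g1 h1; rewrite det_mulmx g1 h1 mulr1. Qed.

Lemma detS : \det Smx = 1. Proof. by rewrite det_mx2. Qed.
Lemma detT : \det Tmx = 1. Proof. by rewrite det_mx2. Qed.

(** The Euclidean algorithm on the first column shows that S and T generate SL(2,Z); the induction
    is on the absolute value of the lower left entry. *)
Lemma SL2_ind (P : 'M[int]_2 -> Prop) :
  P Smx -> P Tmx ->
  (forall g h, \det g = 1 -> \det h = 1 -> P g -> P h -> P (g *m h)) ->
  (forall g, \det g = 1 -> P g -> P (invmx g)) ->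
  forall g, \det g = 1 -> P g.
Proof.
move=> PS PT PM PV.
have Tn (n : int) : P (mx2 1 n 0 1).
  have Tnat (k : nat) : P (mx2 1 k%:Z 0 1).
    elim: k => [|k IH].
      by rewrite -one_mx2 -(mulmxV (det1_unit detT)); apply: PM; rewrite ?det1_inv ?detT //; exact: (PV _ detT PT).
    have -> : mx2 1 k.+1%:Z 0 1 = Tmx *m mx2 1 k%:Z 0 1.
      by rewrite mul_mx2; congr mx2; lia.
    by apply: PM => //; rewrite ?detT // det_mx2; lia.
  case: n => k; first exact: Tnat.
  have d1 : \det (mx2 1 k.+1%:Z 0 1) = 1 by rewrite det_mx2; lia.
  suff -> : mx2 1 (Negz k) 0 1 = invmx (mx2 1 k.+1%:Z 0 1) by exact: PV (Tnat k.+1).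
  apply: (can_inj (mulKmx (det1_unit d1))).
  rewrite mulmxV ?det1_unit // mul_mx2 one_mx2; congr mx2; lia.
(* S^2 = -1 reaches the upper triangular matrices with diagonal entries -1. *)
have PN : P (mx2 (-1) 0 0 (-1)).
  have -> : mx2 (-1) 0 0 (-1) = Smx *m Smx by rewrite mul_mx2.
  by apply: PM; rewrite ?detS.
move=> g; move: {2}(absz (g 1 0)).+1 (ltnSn (absz (g 1 0))) => N.
elim: N g => // N IH g; rewrite ltnS => gN g1.
move: gN g1; rewrite {2 3}(mx2_eta g) => gN.
move: (g 0 0) (g 0 1) (g 1 0) (g 1 1) gN => a b c d; rewrite det_mx2 => cN adbc.
have [c0|c0] := eqVneq c 0.
  have : a * d = 1 by rewrite -adbc c0; lia.
  rewrite c0 => ad.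
  have [[-> ->]|[-> ->]] : (a = 1 /\ d = 1) \/ (a = -1 /\ d = -1).
    have /eqP : (`|a| * `|d|)%N = 1%N by rewrite -abszM ad.
    by rewrite muln_eq1 => /andP[/eqP a1 /eqP d1]; lia.
  - exact: Tn.
  - have -> : mx2 (-1) b 0 (-1) = mx2 (-1) 0 0 (-1) *m mx2 1 (-b) 0 1.
      by rewrite mul_mx2; congr mx2; lia.
    by apply: PM => //; rewrite det_mx2; lia.
(* Splitting off T^q S leaves a matrix with first column (c, - (a mod c)), whose lower left entry is
   smaller in absolute value than c. *)
pose q := (a %/ c)%Z.
have aq : a = q * c + (a %% c)%Z by exact: divz_eq.
have -> : mx2 a b c d = (mx2 1 q 0 1 *m Smx) *m mx2 c d (- (a - q * c)) (- (b - q * d)).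
  by rewrite !mul_mx2; congr mx2; ring.
have h1 : \det (mx2 1 q 0 1) = 1 by rewrite det_mx2; ring.
have h2 : \det (mx2 c d (- (a - q * c)) (- (b - q * d))) = 1.
  by rewrite det_mx2 -adbc; ring.
apply: (PM) => //; first exact: det1_mul h1 detS.
  by apply: PM; rewrite ?detS.
apply: IH => //; rewrite mxE /=.
have := modz_ge0 a c0; have := ltz_mod a c0; lia.
Qed.

(** Bezout coefficients of the first column give a unimodular matrix that turns this column into (a,
    0), with a its gcd; a translation then reduces the upper right entry modulo d. *)
Lemma hermite_form M (m : nat) : (0 < m)%N -> \det M = m%:Z ->
  exists g a b d, [/\ \det g = 1, M = g *m mx2 a%:Z b%:Z 0 d%:Z, (a * d = m)%N & (b < d)%N].
Proof.
move=> m0; rewrite {1 2}(mx2_eta M).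
move: (M 0 0) (M 0 1) (M 1 0) (M 1 1) => p q r s; rewrite det_mx2 => dM.
have g0 : gcdz p r != 0.
  by rewrite gcdz_eq0; apply/negP => /andP[/eqP p0 /eqP r0]; move: dM; rewrite p0 r0; lia.
pose a := gcdz p r.
have a_gt0 : 0 < a by rewrite lt_neqAle eq_sym g0.
have [x [y xy]] := Bezoutz p r.
pose p' := (p %/ a)%Z; pose r' := (r %/ a)%Z.
have pE : p = p' * a by rewrite divzK // dvdz_gcdl.
have rE : r = r' * a by rewrite divzK // dvdz_gcdr.
have xy1 : x * p' + y * r' = 1.
  by apply: (mulIf g0); rewrite -/a mul1r -[RHS]xy pE rE; ring.
pose d := p' * s - r' * q.
have dE : a * d = m%:Z by rewrite -dM /d [in RHS]pE [in RHS]rE; ring.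
have d_gt0 : 0 < d by nia.
(* The upper right entry once the first column is cleared; t is the translation that brings it into
   [0, d). *)
pose b0 := x * q + y * s.
pose t := (b0 %/ d)%Z; pose b := (b0 %% d)%Z.
have b0E : b0 = t * d + b by exact: divz_eq.
have b_ge0 : 0 <= b by apply: modz_ge0; lia.
have b_lt : b < d by apply: ltz_pmod.
(* The first witness is the inverse of [x, y; - r', p'] times T^t. *)
exists (mx2 p' (- y + p' * t) r' (x + r' * t)), `|a|%N, `|b|%N, `|d|%N.
rewrite det_mx2 mul_mx2 !gez0_abs //; [|lia..].
split; [by rewrite -xy1; ring | | lia | lia].
congr mx2; rewrite ?mulr0 ?addr0 //.
- have -> : p' * b + (- y + p' * t) * d = p' * b0 - y * d by rewrite b0E; ring.
  by rewrite /b0 /d -[LHS]mulr1 -xy1; ring.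
- have -> : r' * b + (x + r' * t) * d = r' * b0 + x * d by rewrite b0E; ring.
  by rewrite /b0 /d -[LHS]mulr1 -xy1; ring.
Qed.

(** The zero below the diagonal makes g upper triangular, positivity makes its diagonal entries 1,
    and the remaining translation vanishes because b and b' both lie in [0, d). *)
Lemma hermite_uniq g (a b d a' b' d' : nat) : \det g = 1 ->
  g *m mx2 a%:Z b%:Z 0 d%:Z = mx2 a'%:Z b'%:Z 0 d'%:Z ->
  (0 < a)%N -> (b < d)%N -> (0 < a')%N -> (b' < d')%N -> (a = a' /\ b = b')%N.
Proof.
rewrite (mx2_eta g).
move: (g 0 0) (g 0 1) (g 1 0) (g 1 1) => p q r s; rewrite det_mx2 mul_mx2 => dg.
move=> /matrixP E; have := E 0 0; have := E 0 1; have := E 1 0; have := E 1 1.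
rewrite !mxE /= {E} => E11 E10 E01 E00 a0 bd a'0 b'd'.
have r0 : r = 0.
  by apply/eqP; move: E10 => /eqP; rewrite mulr0 addr0 mulf_eq0; lia.
have p_gt0 : 0 < p.
  have a_gt0 : 0 < a%:Z by lia.
  by rewrite -(pmulr_lgt0 _ a_gt0); move: E00; rewrite mulr0 addr0; lia.
have ps : p * s = 1 by rewrite -dg r0; ring.
have s_gt0 : 0 < s by rewrite -(pmulr_rgt0 _ p_gt0) ps.
have [p1 s1] : p = 1 /\ s = 1 by nia.
rewrite p1 r0 s1 in E00 E01 E11.
have dd : d = d' by lia.
have q0 : q = 0.
  move: E01; rewrite mul1r => E01.
  have d_gt0 : 0 < d%:Z by lia.
  have q_lt1 : q < 1 by rewrite -(ltr_pM2r d_gt0) mul1r; lia.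
  have q_gtN1 : -1 < q by rewrite -(ltr_pM2r d_gt0) mulN1r; lia.
  by lia.
by rewrite q0 in E01; lia.
Qed.

End Matrices.

(** * The multiplier system of eta ^ (2k) *)

Section ComplexExponential.
Variable R : realType.
Implicit Types (x y : R) (z s : R[i]).

Lemma imaginaryE : 'i = Complex 0 1 :> R[i].
Proof. by []. Qed.

Lemma complexReM z s : complex.Re (z * s) = complex.Re z * complex.Re s - complex.Im z * complex.Im s.
Proof. by case: z; case: s. Qed.

Lemma complexImM z s : complex.Im (z * s) = complex.Re z * complex.Im s + complex.Im z * complex.Re s.
Proof. by case: z; case: s. Qed.

Lemma cexpD z s : cexp (z + s) = cexp z * cexp s.
Proof.
case: z => a b; case: s => c d; rewrite /cexp /= expRD cosD sinD.
by apply/eqP; rewrite eq_complex /=; apply/andP; split; apply/eqP; ring.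
Qed.

Lemma cexp0 : cexp (0 : R[i]) = 1.
Proof. by rewrite /cexp /= expR0 cos0 sin0 mul1r. Qed.

Lemma cexp_neq0 z : cexp z != 0.
Proof.
apply/eqP => z0; have := cexpD z (- z); rewrite subrr cexp0 z0 mul0r.
by move/eqP; rewrite oner_eq0.
Qed.

Lemma cexpN z : cexp (- z) = (cexp z)^-1.
Proof.
by apply: (mulfI (cexp_neq0 z)); rewrite -cexpD subrr cexp0 divff ?cexp_neq0.
Qed.

Lemma e2piD z s : e2pi (z + s) = e2pi z * e2pi s.
Proof. by rewrite /e2pi mulrDr cexpD. Qed.

Lemma e2pi0 : e2pi (0 : R[i]) = 1.
Proof. by rewrite /e2pi mulr0 cexp0. Qed.

Lemma e2pi_neq0 z : e2pi z != 0. Proof. exact: cexp_neq0. Qed.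

Lemma e2piN z : e2pi (- z) = (e2pi z)^-1.
Proof. by rewrite /e2pi mulrN cexpN. Qed.

Lemma e2pi1 : e2pi (1 : R[i]) = 1.
Proof.
have -> : e2pi (1 : R[i]) = cexp (Complex 0 (pi *+ 2)).
  by congr cexp; rewrite mulr1; apply/eqP; rewrite eq_complex /=; apply/andP; split; apply/eqP; ring.
by rewrite /cexp /= expR0 cos2pi sin2pi mul1r.
Qed.

Lemma e2piMn z (n : nat) : e2pi (n%:R * z) = e2pi z ^+ n.
Proof.
elim: n => [|n IH]; first by rewrite mul0r e2pi0 expr0.
by rewrite -natr1 mulrDl mul1r e2piD IH exprSr.
Qed.

Lemma e2piMz z (n : int) : e2pi (n%:~R * z) = e2pi z ^ n.
Proof.
case: n => n; first exact: e2piMn.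
by rewrite NegzE rmorphN mulNr e2piN -exprnN e2piMn.
Qed.

Lemma e2pi_int (n : int) : e2pi (n%:~R : R[i]) = 1.
Proof. by rewrite -[X in e2pi X]mulr1 e2piMz e2pi1 exp1rz. Qed.

Lemma e2pi_quarter : e2pi (4%:R^-1 : R[i]) = 'i.
Proof.
have -> : e2pi (4%:R^-1 : R[i]) = cexp (Complex 0 (pi / 2)).
  congr cexp; rewrite -(rmorph_nat (real_complex R)) -fmorphV.
  apply/eqP; rewrite eq_complex /=; apply/andP; split; apply/eqP.
  - by ring.
  - by field.
by rewrite /cexp /= expR0 cos_pihalf sin_pihalf mul1r.
Qed.

(** The multipliers and, up to the factor m^(-1/2), the Hecke weights are powers of this root of
    unity, so that identities between them become congruences of exponents modulo 12. *)
Definition zeta12 : R[i] := e2pi (12%:R^-1).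

Lemma zeta12_neq0 : zeta12 != 0. Proof. exact: e2pi_neq0. Qed.

Lemma zeta12X12 : zeta12 ^ 12 = 1.
Proof. by rewrite -e2piMz divff ?e2pi1 // pnatr_eq0. Qed.

Lemma zeta12D m n : zeta12 ^ (m + n) = zeta12 ^ m * zeta12 ^ n.
Proof. by rewrite expfzDr ?zeta12_neq0. Qed.

Lemma zeta12_mod m n : (12 %| m - n)%Z -> zeta12 ^ m = zeta12 ^ n.
Proof.
move=> /dvdzP[q mn]; have -> : m = n + 12 * q by lia.
by rewrite zeta12D -exprz_exp zeta12X12 exp1rz mulr1.
Qed.

Lemma zeta12_3 (n : int) : zeta12 ^ (3 * n) = 'i ^ n.
Proof.
rewrite -exprz_exp -e2piMz; congr (_ ^ n); rewrite -e2pi_quarter; congr e2pi.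
by apply: (mulIf (_ : 12%:R != 0)); rewrite ?pnatr_eq0 //; field.
Qed.

Lemma zeta12_e2pi (n : int) : zeta12 ^ n = e2pi (n%:~R / 12).
Proof. by rewrite -e2piMz. Qed.

End ComplexExponential.

(** The multiplier exponent of M diag(1, -1) for M = [a, b; c, d]. *)
Definition psi (R : pzRingType) (a b c d : R) : R := phi a (- b) c (- d).

Lemma psi_intr (R : pzRingType) (a b c d : int) :
  (psi a b c d)%:~R = psi (a%:~R : R) b%:~R c%:~R d%:~R.
Proof.
by rewrite /psi /phi !(rmorphD, rmorphM, rmorphB, rmorphXn, rmorph1, rmorphN, rmorph_nat).
Qed.

(** The four congruences describe the effect on [psi] of T M, S M, M T and M S, in this order. *)
Lemma dvdz12_psi (kap a b c d : int) (m : nat) :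
  a * d - b * c = m%:Z -> (12 %| kap * (m%:Z + 1))%Z ->
  [/\ (12 %| kap * (psi (a + c) (b + d) c d - (psi a b c d + 1)))%Z,
      (12 %| kap * (psi (- c) (- d) a b - (psi a b c d - 3)))%Z,
      (12 %| kap * (psi a (a + b) c (c + d) - (psi a b c d - 1)))%Z &
      (12 %| kap * (psi b (- a) d (- c) - (psi a b c d + 3)))%Z].
Proof.
pose cast := (psi_intr, rmorphB, rmorphD, rmorphM, rmorphN, rmorph1, rmorph_nat).
(* The casts are stated over an arbitrary ring to serve the moduli 2, 3 and 4 alike. *)
have castD (Q : pzRingType) : (a * d - b * c + 1)%:~R =
  a%:~R * d%:~R - b%:~R * c%:~R + 1 :> Q by rewrite !cast.
have cast1 (Q : pzRingType) : (psi (a + c) (b + d) c d - (psi a b c d + 1))%:~R =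
  psi (a%:~R + c%:~R) (b%:~R + d%:~R) c%:~R d%:~R - (psi a%:~R b%:~R c%:~R d%:~R + 1) :> Q.
  by rewrite !cast.
have cast2 (Q : pzRingType) : (psi (- c) (- d) a b - (psi a b c d - 3))%:~R =
  psi (- c%:~R) (- d%:~R) a%:~R b%:~R - (psi a%:~R b%:~R c%:~R d%:~R - 3%:R) :> Q.
  by rewrite !cast.
have cast3 (Q : pzRingType) : (psi a (a + b) c (c + d) - (psi a b c d - 1))%:~R =
  psi a%:~R (a%:~R + b%:~R) c%:~R (c%:~R + d%:~R) - (psi a%:~R b%:~R c%:~R d%:~R - 1) :> Q.
  by rewrite !cast.
have cast4 (Q : pzRingType) : (psi b (- a) d (- c) - (psi a b c d + 3))%:~R =
  psi b%:~R (- a%:~R) d%:~R (- c%:~R) - (psi a%:~R b%:~R c%:~R d%:~R + 3%:R) :> Q.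
  by rewrite !cast.
(* What remains are implications between congruences modulo 2, 3 and 4, each decided by running
   through all quadruples of residues. *)
move=> <- h12; split; apply: (dvdz12_mul h12);
  rewrite !dvdz_Zp // castD (cast1, cast2, cast3, cast4);
  clear; move: (a%:~R) (b%:~R) (c%:~R) (d%:~R) => {}a {}b {}c {}d; apply/implyP;
  by move: a b c d; apply: all4P; [|vm_compute].
Qed.

(** Units modulo a divisor of 12 are their own inverses, so a d = -1 forces d = - a and d^2 = 1. *)
Lemma dvdz12_sum_sqr (kap : int) (a d : nat) : (12 %| kap * ((a * d)%N%:Z + 1))%Z ->
  (12 %| kap * (a%:Z + d%:Z))%Z /\ (12 %| kap * (d%:Z ^+ 2 - 1))%Z.
Proof.
move=> h12; split; apply: (dvdz12_mul h12);
  rewrite PoszM !dvdz_Zp // !(rmorphB, rmorphD, rmorphM, rmorph1, rmorphXn) /=;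
  clear h12; move: (a%:~R) (d%:~R) => {}a {}d; apply/implyP;
  by move: a d; apply: all2P; [|vm_compute].
Qed.


(** * Characters of SL(2,Z) and their extension to determinant m *)

Section Multiplier.
Variables (R : realType) (kap : int).
Implicit Types (u : 'M[int]_2 -> R[i]) (g h M : 'M[int]_2).

(** In integral weight a multiplier system is a character, hence determined by its values at T and
    S; kap is k for v and - k for its conjugate. *)
Definition multiplier u : Prop :=
  [/\ forall g h, \det g = 1 -> \det h = 1 -> u (g *m h) = u g * u h,
      u Tmx = zeta12 R ^ kap & u Smx = zeta12 R ^ (- 3 * kap)].

(* The inverse of the multiplier of M diag(1, -1), which is unimodular modulo
   12 when det M = -1 mod 12. *)
Definition coset_weight M : R[i] :=
  zeta12 R ^ (- (kap * psi (M 0 0) (M 0 1) (M 1 0) (M 1 1))).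

Variables (u : 'M[int]_2 -> R[i]) (m : nat).
Hypotheses (u_mult : multiplier u) (km : (12 %| kap * (m%:Z + 1))%Z).

Lemma multiplier1 : u 1%:M = 1.
Proof.
have [uM uT _] := u_mult; have u0 : u Tmx != 0 by rewrite uT expfz_neq0 // zeta12_neq0.
by apply: (mulfI u0); rewrite -uM ?detT ?det1 // mulmx1 mulr1.
Qed.

Lemma multiplierV g : \det g = 1 -> u (invmx g) = (u g)^-1.
Proof.
have [uM _ _] := u_mult => g1.
have e : u g * u (invmx g) = 1.
  by rewrite -uM ?det1_inv // mulmxV ?multiplier1 // det1_unit.
have u0 : u g != 0 by apply/eqP => u0; move: e; rewrite u0 mul0r => /eqP; rewrite eq_sym oner_eq0.
by apply: (mulfI u0); rewrite e divff.
Qed.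

Lemma multiplier_neq0 g : \det g = 1 -> u g != 0.
Proof.
move=> g1; apply/eqP => u0; have [uM _ _] := u_mult.
have := uM _ _ g1 (det1_inv g1); rewrite mulmxV ?det1_unit // multiplier1 u0 mul0r.
by move/eqP; rewrite oner_eq0.
Qed.

(** On the generators this is [dvdz12_psi]. The matrix M stays quantified in the induction, since
    the factors of a product are removed one at a time and change M. *)
Lemma coset_weight_mul g : \det g = 1 -> forall M, \det M = m%:Z ->
  coset_weight (g *m M) = (u g)^-1 * coset_weight M /\
  coset_weight (M *m g) = u g * coset_weight M.
Proof.
have [uM uT uS] := u_mult.
(* Accounts for the minus sign in the exponent of [coset_weight]. *)
have dvdN x y : (12 %| y)%Z -> x = - y -> (12 %| x)%Z by lia.
move: g; apply: SL2_ind.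
- move=> M; rewrite {1 2 4}(mx2_eta M) /coset_weight uS invr_expz -!zeta12D.
  move: (M 0 0) (M 0 1) (M 1 0) (M 1 1) => a b c d; rewrite det_mx2 => dM.
  rewrite !mul_mx2 !mxE /= !(mul0r, mulr0, add0r, addr0, mul1r, mulr1, mulN1r, mulrN1).
  have [_ hl _ hr] := dvdz12_psi dM km.
  by split; apply: zeta12_mod; [apply: (dvdN _ _ hl)|apply: (dvdN _ _ hr)]; ring.
- move=> M; rewrite {1 2 4}(mx2_eta M) /coset_weight uT invr_expz -!zeta12D.
  move: (M 0 0) (M 0 1) (M 1 0) (M 1 1) => a b c d; rewrite det_mx2 => dM.
  rewrite !mul_mx2 !mxE /= !(mul0r, mulr0, add0r, addr0, mul1r, mulr1).
  have [hl _ hr _] := dvdz12_psi dM km.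
  by split; apply: zeta12_mod; [apply: (dvdN _ _ hl)|apply: (dvdN _ _ hr)]; ring.
- move=> g h g1 h1 Pg Ph M dM.
  have dhM : \det (h *m M) = m%:Z by rewrite det_mulmx h1 mul1r.
  have dMg : \det (M *m g) = m%:Z by rewrite det_mulmx g1 mulr1.
  rewrite -mulmxA (Pg _ dhM).1 (Ph _ dM).1 mulmxA (Ph _ dMg).2 (Pg _ dM).2 uM //.
  by rewrite invfM !mulrA; split=> //; rewrite [u h * _]mulrC.
- move=> g g1 Pg M dM; rewrite multiplierV // invrK.
  have dl : \det (invmx g *m M) = m%:Z by rewrite det_mulmx det1_inv // mul1r.
  have dr : \det (M *m invmx g) = m%:Z by rewrite det_mulmx det1_inv // mulr1.
  have u0 := multiplier_neq0 g1.
  split.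
    by have := (Pg _ dl).1; rewrite mulKVmx ?det1_unit // => ->; rewrite mulVKf.
  by have := (Pg _ dr).2; rewrite mulmxKV ?det1_unit // => ->; rewrite mulKf.
Qed.

(** For c = 0 the exponent is - kap (b d + 3 d + 3), in which d may be replaced by - a in the middle
    term because 12 divides kap (a + d). The part 3 kap (a - 1) is the source of the character
    chi. *)
Lemma coset_weight_hermite (a b d : nat) : (a * d = m)%N ->
  coset_weight (mx2 a%:Z b%:Z 0 d%:Z) = zeta12 R ^ (kap * (3 * (a%:Z - 1) - b%:Z * d%:Z)).
Proof.
move=> ad; rewrite /coset_weight !mxE /= /psi /phi; apply: zeta12_mod.
have [h _] := @dvdz12_sum_sqr kap a d (eq_ind_r (fun m => is_true (12 %| kap * (m%:Z + 1))%Z) km ad).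
rewrite (_ : _ - _ = - 3 * (kap * (a%:Z + d%:Z))); last by ring.
by rewrite dvdz_mull.
Qed.

End Multiplier.

(** * The action on the upper half-plane *)

Section Moebius.
Variable R : realType.
Implicit Types (z w : R[i]) (g h : 'M[int]_2).

Lemma intCE (n : int) : n%:~R = (n%:~R)%:C :> R[i].
Proof. by rewrite rmorph_int. Qed.

Lemma natCE (n : nat) : n%:R = (n%:R)%:C :> R[i].
Proof. by rewrite rmorph_nat. Qed.

Lemma denom_neq0 g z : \det g != 0 -> uhp z -> denom g z != 0.
Proof.
case: z => x y; rewrite /uhp /= => g0 y0.
apply/eqP; rewrite /denom !intCE => /eqP; rewrite eq_complex /=.
rewrite !mul0r !addr0 subr0 => /andP[/eqP re /eqP im].
have c0 : g 1 0 = 0.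
  by apply/eqP; rewrite -(intr_eq0 R); move: im => /eqP; rewrite mulf_eq0 (gt_eqF y0) orbF.
have d0 : g 1 1 = 0.
  by apply/eqP; rewrite -(intr_eq0 R); move: re; rewrite c0 mul0r add0r => ->.
by move: g0; rewrite (mx2_eta g) det_mx2 c0 d0 !mulr0 subr0 eqxx.
Qed.

Lemma uhp_mobius g z : 0 < \det g -> uhp z -> uhp (mobius g z).
Proof.
move=> g0 zH; have := denom_neq0 (lt0r_neq0 g0) zH.
move: g0 zH; case: z => x y; rewrite {1}(mx2_eta g) det_mx2 /uhp /mobius /denom /=.
move: (g 0 0) (g 0 1) (g 1 0) (g 1 1) => a b c d g0 y0.
rewrite !intCE eq_complex /= !mul0r !addr0 !subr0 negb_and => den.
move: g0; rewrite -(ltr_int R) rmorphB !rmorphM /=.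
move: (a%:~R) (b%:~R) (c%:~R) (d%:~R) den => {}a {}b {}c {}d den g0.
have n0 : 0 < (c * x + d) ^+ 2 + (c * y) ^+ 2.
  rewrite lt_neqAle addr_ge0 ?sqr_ge0 // andbT eq_sym paddr_eq0 ?sqr_ge0 //.
  by rewrite !sqrf_eq0 negb_and.
rewrite (_ : _ + _ = (a * d - b * c) * y / ((c * x + d) ^+ 2 + (c * y) ^+ 2)).
  by rewrite divr_gt0 // mulr_gt0.
by field; rewrite gt_eqF.
Qed.

Lemma mulmx2E (g h : 'M[int]_2) i j : (g *m h) i j = g i 0 * h 0 j + g i 1 * h 1 j.
Proof.
rewrite !mxE !big_ord_recl big_ord0 addr0.
by have -> : lift 0 0 = 1 :> 'I_2 by exact: val_inj.
Qed.

Lemma denom_mul g h z : \det h != 0 -> uhp z ->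
  denom (g *m h) z = denom g (mobius h z) * denom h z.
Proof.
move=> h0 zH; have := denom_neq0 h0 zH.
by rewrite /mobius /denom !mulmx2E !rmorphD !rmorphM /= => D0; field.
Qed.

Lemma mobius_mul g h z : 0 < \det g -> 0 < \det h -> uhp z ->
  mobius (g *m h) z = mobius g (mobius h z).
Proof.
move=> g0 h0 zH; have D0 := denom_neq0 (lt0r_neq0 h0) zH.
have E0 := denom_neq0 (lt0r_neq0 g0) (uhp_mobius h0 zH).
rewrite [LHS]/mobius denom_mul ?lt0r_neq0 //.
have -> : mobius g (mobius h z) =
    ((g 0 0)%:~R * mobius h z + (g 0 1)%:~R) / denom g (mobius h z) by [].
move: (denom g _) E0 => E E0; rewrite /mobius.
move: D0; rewrite /denom !mulmx2E !rmorphD !rmorphM /= => D0.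
by field; rewrite E0 D0.
Qed.

End Moebius.

(** * Non-vanishing of eta at i and its multiplier system *)

Section Eta.
Variable R : realType.

Lemma cvg_real_complex (u : nat -> R) (l : R) : u @ \oo --> l ->
  (fun n => (u n)%:C) @ \oo --> l%:C.
Proof.
move=> /cvgrPdist_lt ul; apply/cvgrPdist_lt => e e0.
have er : e = (complex.Re e)%:C by rewrite RRe_real // gtr0_real.
have re0 : 0 < complex.Re e by move: e0; rewrite er ltcR.
near=> n; rewrite -rmorphB /= normc_def /= expr0n addr0 sqrtr_sqr er ltcR.
by near: n; exact: ul.
Unshelve. all: by end_near. Qed.

Lemma limn_complex (u : nat -> R[i]) (l : R[i]) : u @ \oo --> l -> limn u = l.
Proof. by move/cvg_lim => ->. Qed.

(** The value of e(z) at z = i; it is real, so the eta product at i can be estimated over the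
    reals. *)
Definition nome : R := expR (- (2 * pi)).

Lemma e2pi_i : e2pi ('i : R[i]) = nome%:C.
Proof.
have -> : e2pi ('i : R[i]) = cexp (Complex (- (2 * pi)) 0).
  by congr cexp; apply/eqP; rewrite eq_complex /=; apply/andP; split; apply/eqP; ring.
by rewrite /cexp /= cos0 sin0 mulr1.
Qed.

Lemma nome_gt0 : 0 < nome. Proof. exact: expR_gt0. Qed.

Lemma nome_le : nome <= 4^-1.
Proof.
rewrite /nome expRN lef_pV2 ?posrE ?expR_gt0 //.
have := expR_ge1Dx (2 * pi : R); have := pi_ge2 R; lra.
Qed.

Let P N := \prod_(1 <= n < N.+1) (1 - nome ^+ n).

Let nomeX N : nome ^+ N <= 4^-1 ^+ N.
Proof. by rewrite lerXn2r ?nnegrE ?(ltW nome_gt0) ?nome_le. Qed.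

(** The term in 4^-N carries the induction: (1/2 + x/2)(1 - x/4) >= 1/2 + x/8 for 0 <= x <= 1, with
    x = 4^-N. *)
Let P_ge N : 2^-1 + 2^-1 * 4^-1 ^+ N <= P N.
Proof.
elim: N => [|N IH]; first by rewrite /P big_geq // expr0; lra.
rewrite /P big_nat_recr //= -/(P N).
have hN := nomeX N.+1.
have x0 : 0 <= 4^-1 ^+ N :> R by rewrite exprn_ge0.
have x1 : 4^-1 ^+ N <= 1 :> R by rewrite exprn_ile1 //; lra.
move: hN IH; rewrite !exprS; move: (4^-1 ^+ N) (P N) x0 x1 => x p x0 x1.
rewrite -exprS; move: (nome ^+ _) => q hq hp.
have : (2^-1 + 2^-1 * x) * (1 - 4^-1 * x) <= p * (1 - q).
  by apply: ler_pM; nra.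
nra.
Qed.

(** The partial products at i decrease and stay above 1/2, hence so does their limit. *)
Lemma eta_i_neq0 : Defs.eta ('i : R[i]) != 0.
Proof.
have Pcvg : cvgn P.
  apply: nonincreasing_is_cvgn.
    apply/nonincreasing_seqP => N; rewrite /P [leLHS]big_nat_recr //= -/(P N).
    rewrite ler_piMr //.
      by apply: le_trans (P_ge N); rewrite addr_ge0 // mulr_ge0 // exprn_ge0.
    by rewrite gerBl exprn_ge0 // ltW // nome_gt0.
  exists 2^-1 => _ [N _ <-]; apply: le_trans (P_ge N).
  by rewrite lerDl mulr_ge0 // exprn_ge0.
have Plim : 2^-1 <= limn P.
  apply: limr_ge => //; near=> N; apply: le_trans (P_ge N).
  by rewrite lerDl mulr_ge0 // exprn_ge0.
rewrite /Defs.eta; apply: mulf_neq0; first exact: e2pi_neq0.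
have -> : (fun N : nat => \prod_(1 <= n < N.+1) (1 - e2pi (n%:R * ('i : R[i])))) = (fun N => (P N)%:C).
  apply/funext => N; rewrite /P rmorph_prod; apply: eq_bigr => n _.
  by rewrite e2piMn e2pi_i rmorphB rmorph1 rmorphXn.
rewrite (limn_complex (cvg_real_complex Pcvg)).
rewrite (_ : 0 = 0%:C) // (inj_eq (@complexI R)) gt_eqF //.
by apply: lt_le_trans Plim.
Unshelve. all: by end_near. Qed.

Lemma eta_add1 (z : R[i]) : Defs.eta (z + 1) = e2pi (24%:R^-1) * Defs.eta z.
Proof.
rewrite /Defs.eta mulrDl div1r e2piD mulrA; congr (_ * _); first by rewrite mulrC.
congr (limn _); apply/funext => N; apply: eq_bigr => n _.
by rewrite mulrDr mulr1 e2piD (_ : n%:R = n%:~R) // e2pi_int mulr1.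
Qed.

(** Since eta(i) is nonzero, comparing both sides of the transformation laws at z = i determines v
    there: the cocycle relation of [denom] gives multiplicativity, and the translation z + 1 gives
    v(T). *)
Lemma eta_multiplierP (k : nat) (v : 'M[int]_2 -> R[i]) :
  eta_multiplier k v -> multiplier k%:Z v.
Proof.
move=> vE; have iH : uhp ('i : R[i]) by rewrite /uhp imaginaryE /=.
have e0 : Defs.eta ('i : R[i]) ^+ (2 * k) != 0 by rewrite expf_neq0 // eta_i_neq0.
have nz g : \det g = 1 -> v g != 0.
  by move=> /vE[v1 _]; rewrite -normr_eq0 v1 oner_eq0.
have d0 g z : \det g = 1 -> uhp z -> denom g z != 0.
  by move=> g1; apply: denom_neq0; rewrite g1.
have vM g h : \det g = 1 -> \det h = 1 -> v (g *m h) = v g * v h.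
  move=> g1 h1; have [_ gE] := vE _ g1; have [_ hE] := vE _ h1.
  have [_ /(_ _ iH)] := vE _ (det1_mul g1 h1).
  have hH : uhp (mobius h 'i : R[i]) by apply: uhp_mobius; rewrite ?h1.
  rewrite mobius_mul ?g1 ?h1 // gE // hE // denom_mul ?h1 //.
  have gi0 : denom g (mobius h 'i : R[i]) ^+ k != 0 by rewrite expf_neq0 // d0.
  have hi0 : denom h ('i : R[i]) ^+ k != 0 by rewrite expf_neq0 // d0.
  move: (Defs.eta _ ^+ _) e0 => et et0; rewrite exprMn => E.
  apply: (mulIf et0); apply: (mulIf gi0); apply: (mulIf hi0).
  move: (denom _ _ ^+ k) (denom _ _ ^+ k) E => x y E.
  transitivity (v (g *m h) * (y * x) * et); first by ring.
  by rewrite -E; ring.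
have vT : v Tmx = zeta12 R ^ k%:Z.
  have [_ /(_ _ iH)] := vE _ detT.
  have -> : mobius Tmx ('i : R[i]) = 'i + 1.
    by rewrite /mobius /denom !mxE /= mul0r add0r mul1r divr1.
  have -> : denom Tmx ('i : R[i]) = 1 by rewrite /denom !mxE /= mul0r add0r.
  rewrite eta_add1 expr1n mulr1; move: (Defs.eta _) e0 => et e0.
  rewrite exprMn => /(mulIf e0) <-.
  rewrite exprM -exprnP; congr (_ ^+ _).
  by rewrite -e2piMn; congr e2pi; field.
split=> //.
have v1 : v 1%:M = 1.
  by apply: (mulfI (nz _ detT)); rewrite -vM ?detT ?det1 // mulmx1 mulr1.
have S0 := nz _ detS.
have dST : \det (Smx *m Tmx) = 1 by rewrite det1_mul ?detS ?detT.
(* (S T)^3 = S^2 forces v(S) = v(T)^-3 *)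
have rel : (Smx *m Tmx) *m ((Smx *m Tmx) *m (Smx *m Tmx)) = Smx *m Smx.
  by rewrite !mul_mx2; congr mx2.
have /(congr1 v) := rel; rewrite !vM ?det1_mul ?detS ?detT // => E.
have E3 : v Smx * v Tmx ^+ 3 = 1.
  by apply: (mulIf S0); apply: (mulIf S0); rewrite mul1r -E; ring.
apply: (mulfI (expf_neq0 3 (nz _ detT))).
rewrite mulrC E3 vT exprnP exprz_exp -zeta12D.
by rewrite (_ : _ + _ = 0) //; ring.
Qed.

Lemma eta_multiplier_conjP (k : nat) (v : 'M[int]_2 -> R[i]) :
  eta_multiplier k v -> multiplier (- k%:Z) (fun g => (v g)^*).
Proof.
move=> vE; have [vM vT vS] := eta_multiplierP vE.
have vV g : \det g = 1 -> (v g)^* = (v g)^-1.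
  by move=> /vE[v1 _]; rewrite invC_norm v1 expr1n invr1 mul1r.
split=> [g h g1 h1||].
- by rewrite vM // rmorphM.
- by rewrite vV ?detT // vT invr_expz.
- by rewrite vV ?detS // vS invr_expz; congr (_ ^ _); ring.
Qed.

End Eta.

(** * Hecke operators and automorphy *)

Section Hecke.
Variable R : realType.
Implicit Types (f : R[i] -> R[i]) (z : R[i]) (kap : int).

(** The factor m^(-1/2) cancels d sqrt(a / d) = sqrt m, where d comes from the sum over b and sqrt(a
    / d) from the normalisation of the Fourier basis. *)
Definition hecke_weight kap (m a b : nat) : R[i] :=
  (Num.sqrt m%:R)^-1%:C *
  zeta12 R ^ (kap * (3 * (a%:Z - 1) - b%:Z * (m %/ a)%N%:Z)).

Definition hecke kap (m : nat) f z : R[i] :=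
  \sum_(1 <= a < m.+1 | (a %| m)%N) \sum_(0 <= b < (m %/ a)%N)
    hecke_weight kap m a b * f ((a%:R * z + b%:R) / (m %/ a)%N%:R).

Lemma hecke_operator_hecke kap m : hecke_operator m (hecke kap m).
Proof. by exists (hecke_weight kap m). Qed.

(** A single finite set of pairs replaces the dependent double range, so that the sum can be
    reindexed by a permutation. *)
Definition hecke_index (m : nat) : {set 'I_m.+1 * 'I_m.+1} :=
  [set p : 'I_m.+1 * 'I_m.+1 | [&& (0 < p.1)%N, (p.1 %| m)%N & (p.2 < m %/ p.1)%N]].

Lemma hecke_index_sum (V : nmodType) (m : nat) (F : nat -> nat -> V) :
  \sum_(1 <= a < m.+1 | (a %| m)%N) \sum_(0 <= b < (m %/ a)%N) F a b =
  \sum_(p in hecke_index m) F p.1 p.2.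
Proof.
rewrite (big_nat_widenl 1 0) // big_mkord.
under eq_bigr => a _.
  rewrite big_mkord (big_ord_widen m.+1 (fun b => F a b)); last first.
    by rewrite ltnW // ltnS leq_div.
  over.
rewrite pair_big_dep; apply: eq_bigl => -[a b] /=.
by rewrite inE /= -andbA; case: (a %| m)%N; rewrite ?andbF // andTb.
Qed.

Definition hecke_rep (m a b : nat) : 'M[int]_2 := mx2 a%:Z b%:Z 0 (m %/ a)%N%:Z.

Lemma det_hecke_rep m a b : (a %| m)%N -> \det (hecke_rep m a b) = m%:Z.
Proof. by move=> am; rewrite det_mx2 mulr0 subr0 -PoszM mulnC divnK. Qed.

Lemma denom_hecke_rep m a b z : denom (hecke_rep m a b) z = (m %/ a)%N%:R.
Proof. by rewrite /denom !mxE /= mul0r add0r. Qed.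

Lemma mobius_hecke_rep m a b z :
  mobius (hecke_rep m a b) z = (a%:R * z + b%:R) / (m %/ a)%N%:R.
Proof. by rewrite /mobius denom_hecke_rep !mxE. Qed.

(** Right multiplication by g permutes the left cosets of SL(2,Z) in the matrices of determinant m,
    and each coset contains exactly one Hermite form. *)
Lemma hecke_rep_permute (m : nat) (g : 'M[int]_2) : (0 < m)%N -> \det g = 1 ->
  exists h : 'I_m.+1 * 'I_m.+1 -> 'I_m.+1 * 'I_m.+1,
    [/\ {in hecke_index m &, injective h}, h @: hecke_index m = hecke_index m &
    forall p, p \in hecke_index m -> exists g', \det g' = 1 /\
      hecke_rep m p.1 p.2 *m g = g' *m hecke_rep m (h p).1 (h p).2].
Proof.
move=> m0 g1.
have [h hP] : {h : 'I_m.+1 * 'I_m.+1 -> 'I_m.+1 * 'I_m.+1 & forall p, p \in hecke_index m ->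
    h p \in hecke_index m /\ exists g', \det g' = 1 /\
      hecke_rep m p.1 p.2 *m g = g' *m hecke_rep m (h p).1 (h p).2}.
  apply: (@boolp.choice _ _ (fun p q => p \in hecke_index m -> q \in hecke_index m /\ exists g', \det g' = 1 /\
      hecke_rep m p.1 p.2 *m g = g' *m hecke_rep m q.1 q.2)) => -[a b].
  (* Outside the index set the value of h is arbitrary. *)
  have [pA|pA] := boolP ((a, b) \in hecke_index m); last by exists (a, b).
  move: (pA); rewrite inE /= => /and3P[a0 am bd].
  have := @hermite_form (hecke_rep m a b *m g) m m0.
  rewrite det_mulmx g1 mulr1 det_hecke_rep // => /(_ erefl).
  move=> [g' [a' [b' [d' [g'1 E ad' bd']]]]].
  have a'0 : (0 < a')%N by rewrite lt0n; apply: contraTneq m0 => a'0; rewrite -ad' a'0.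
  have dE : (m %/ a' = d')%N by rewrite -ad' mulKn.
  have a'm : (a' < m.+1)%N by rewrite ltnS -ad' leq_pmulr // (leq_ltn_trans _ bd').
  have b'm : (b' < m.+1)%N by rewrite ltnS -ad' (leq_trans (ltnW bd')) // leq_pmull.
  exists (Ordinal a'm, Ordinal b'm) => _; split.
    by rewrite inE /= a'0 dE bd' -ad' dvdn_mulr.
  by exists g'; split => //; rewrite /hecke_rep /= dE.
have hinj : {in hecke_index m &, injective h}.
  move=> [a b] [a' b'] pA pA'; have [_ [u [u1 Eu]]] := hP _ pA; have [_ [v [v1 Ev]]] := hP _ pA'.
  move=> hh; rewrite hh in Eu.
  (* Equal images put both representatives in one left coset, where the Hermite form is unique. *)
  have : (u *m invmx v) *m hecke_rep m a' b' = hecke_rep m a b.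
    have U : hecke_rep m a b = u *m hecke_rep m (h (a', b')).1 (h (a', b')).2 *m invmx g.
      by rewrite -Eu mulmxK // det1_unit.
    have V : hecke_rep m a' b' = v *m hecke_rep m (h (a', b')).1 (h (a', b')).2 *m invmx g.
      by rewrite -Ev mulmxK // det1_unit.
    by rewrite U V !mulmxA mulmxKV // det1_unit.
  have d1 : \det (u *m invmx v) = 1 by rewrite det1_mul ?det1_inv.
  move: pA pA'; rewrite !inE /= => /and3P[a0 am bd] /and3P[a0' am' bd'] E.
  have [ea eb] := hermite_uniq d1 E a0' bd' a0 bd.
  by congr pair; apply: val_inj.
exists h; split => // [|p /hP[]//].
(* An injective map of a finite set into itself is onto. *)
apply/eqP; rewrite eqEcard card_in_imset // leqnn andbT.
by apply/fintype.subsetP => _ /imsetP[p /hP[hp _] ->].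
Qed.

Lemma Arg_scale (t : R) z : 0 < t -> Arg (t%:C * z) = Arg z.
Proof.
case: z => x y t0; rewrite /Arg /cabs !normc_def /= !mul0r !subr0 !addr0.
rewrite pmulr_rge0 // !exprMn -mulrDr sqrtrM ?sqr_ge0 // sqrtr_sqr gtr0_norm //.
by rewrite -mulf_div divff ?gt_eqF // mul1r.
Qed.

Definition automorphic (u : 'M[int]_2 -> R[i]) (k : nat) f : Prop :=
  forall g z, \det g = 1 -> uhp z ->
    f (mobius g z) = u g * cexp ('i * k%:R * (Arg (denom g z))%:C) * f z.

(** The terms are matched along the permutation of cosets; in each pair the automorphy factors and
    the weights are compared separately. *)
Lemma hecke_automorphic kap (u u' : 'M[int]_2 -> R[i]) (k m : nat) f :
  (0 < m)%N -> (12 %| kap * (m%:Z + 1))%Z -> multiplier kap u ->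
  (forall g, \det g = 1 -> u' g = (u g)^-1) ->
  automorphic u k f -> automorphic u' k (hecke kap m f).
Proof.
move=> m0 km umult u'E fu g z g1 zH.
rewrite /hecke !(hecke_index_sum m (fun a b => hecke_weight kap m a b * f ((a%:R * _ + b%:R) / _))).
have [h [hinj hA hP]] := hecke_rep_permute m0 g1.
(* Only the sum on the right is reindexed, so that the term of p faces the term of h p. *)
rewrite -{2}hA big_imset //= mulr_sumr; apply: eq_bigr => p pA.
have [g' [g'1 E]] := hP _ pA.
have := pA; rewrite inE => /and3P[a0 am bd].
have : h p \in hecke_index m by rewrite -hA imset_f.
rewrite inE => /and3P[a0' am' bd'].
rewrite -!mobius_hecke_rep -mobius_mul ?g1 ?det_hecke_rep //.
have r'H : uhp (mobius (hecke_rep m (h p).1 (h p).2) z).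
  by apply: uhp_mobius; rewrite ?det_hecke_rep.
rewrite E mobius_mul ?g'1 ?det_hecke_rep // fu //.
have d_gt0 (a : nat) : (0 < a)%N -> (a %| m)%N -> 0 < (m %/ a)%N%:R :> R.
  by move=> a_gt0 a_dvd; rewrite ltr0n divn_gt0 // dvdn_leq.
(* By the cocycle relation for both factorisations the two denominators agree after multiplication
   by the positive integers d' and d, which do not affect the argument. *)
have -> : Arg (denom g' (mobius (hecke_rep m (h p).1 (h p).2) z)) = Arg (denom g z).
  rewrite -(Arg_scale _ (d_gt0 _ a0' am')) -(Arg_scale (denom g z) (d_gt0 _ a0 am)).
  rewrite -!natCE mulrC -(denom_hecke_rep m (h p).1 (h p).2 z) -denom_mul //; last first.
    by rewrite det_hecke_rep //; lia.
  rewrite -E denom_mul ?g1 // denom_hecke_rep //.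
(* The weight of the matrix in E is computed from both of its factorisations: u(g) w = u(g')^(-1)
   w'. *)
have := coset_weight_mul umult km g1 (det_hecke_rep p.2 am).
move=> [_]; rewrite E (coset_weight_mul umult km g'1 (det_hecke_rep (h p).2 am')).1.
rewrite !(@coset_weight_hermite R kap m) //; try by rewrite mulnC divnK.
rewrite u'E // /hecke_weight.
have := multiplier_neq0 umult g1; have := multiplier_neq0 umult g'1.
move: (u g) (u g') (zeta12 R ^ _) (zeta12 R ^ _) (cexp _) (f _) => x x' w w' c y x'0 x0 E1.
have -> : w = x^-1 * x'^-1 * w' by rewrite -mulrA E1 mulKf.
by move: ((Num.sqrt _)^-1%:C) => s; field; rewrite x'0 x0.
Qed.

End Hecke.

(** * Smoothness and the eigenvalue equation *)

Section ComplexCurves.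
Variable R : realType.
Implicit Types (u : R -> R[i]) (t : R) (w c : R[i]).

(** A relation that carries existence and value of the derivative together, componentwise as in
    [partial_x] and [partial_y]. *)
Definition has_cderiv u t w : Prop :=
  is_derive t 1 (fun s => complex.Re (u s)) (complex.Re w) /\
  is_derive t 1 (fun s => complex.Im (u s)) (complex.Im w).

Lemma has_cderiv_near u u' t w : (\forall s \near t, u s = u' s) ->
  has_cderiv u t w -> has_cderiv u' t w.
Proof.
move=> uu' [ure uim]; split; [move: ure|move: uim]; apply: near_eq_is_derive;
  by near=> s; rewrite (near uu' s).
Unshelve. all: by end_near. Qed.

Lemma has_cderivD u u' t w w' : has_cderiv u t w -> has_cderiv u' t w' ->
  has_cderiv (fun s => u s + u' s) t (w + w').
Proof.
move=> [ure uim] [ure' uim']; split; rewrite raddfD /=.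
  have -> : (fun s => complex.Re (u s + u' s)) =
    (fun s => complex.Re (u s)) \+ (fun s => complex.Re (u' s)) by apply/funext => s; rewrite raddfD.
  exact: is_deriveD.
have -> : (fun s => complex.Im (u s + u' s)) =
  (fun s => complex.Im (u s)) \+ (fun s => complex.Im (u' s)) by apply/funext => s; rewrite raddfD.
exact: is_deriveD.
Qed.

Lemma has_cderivZ c u t w : has_cderiv u t w -> has_cderiv (fun s => c * u s) t (c * w).
Proof.
move=> [ure uim]; split.
  have -> : (fun s => complex.Re (c * u s)) =
    (complex.Re c *: (fun s => complex.Re (u s))) - (complex.Im c *: (fun s => complex.Im (u s))).
    by apply/funext => s; exact: complexReM.

  by rewrite complexReM; exact: is_deriveB.
have -> : (fun s => complex.Im (c * u s)) =
  (complex.Re c *: (fun s => complex.Im (u s))) + (complex.Im c *: (fun s => complex.Re (u s))).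
  by apply/funext => s; exact: complexImM.
by rewrite complexImM; exact: is_deriveD.
Qed.

Lemma has_cderiv_affine (al be : R) u t w : has_cderiv u (al * t + be) w ->
  has_cderiv (fun s => u (al * s + be)) t (al%:C * w).
Proof.
have aff : is_derive t 1 (fun s => al * s + be) al.
  have -> : (fun s => al * s + be) = (al *: id) + cst be by [].
  by apply: is_derive_eq; rewrite addr0; exact: mulr1.
move=> [ure uim]; split; rewrite ?complexReM ?complexImM /= mul0r ?subr0 ?addr0.
  rewrite mulrC.
  exact: (@is_derive1_comp R (fun s => complex.Re (u s)) (fun s => al * s + be) t _ _ ure aff).
rewrite mulrC.
exact: (@is_derive1_comp R (fun s => complex.Im (u s)) (fun s => al * s + be) t _ _ uim aff).
Qed.

End ComplexCurves.

(** * Partial derivatives on the upper half-plane *)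

Section Partials.
Variable R : realType.
Implicit Types (f g : R[i] -> R[i]) (z w c : R[i]).

Definition partials f z wx wy : Prop :=
  has_cderiv (fun t => f (t +i* complex.Im z)) (complex.Re z) wx /\
  has_cderiv (fun t => f (complex.Re z +i* t)) (complex.Im z) wy.

Lemma has_partialsP f z : has_partials f z ->
  partials f z (partial_x f z) (partial_y f z).
Proof.
move=> [a b c d]; split; split.
- exact: (DeriveDef a (esym (derive1E _ _))).
- exact: (DeriveDef b (esym (derive1E _ _))).
- exact: (DeriveDef c (esym (derive1E _ _))).
- exact: (DeriveDef d (esym (derive1E _ _))).
Qed.

Lemma complex_eta z : z = complex.Re z +i* complex.Im z.
Proof. by case: z. Qed.

Lemma partialsE f z wx wy : partials f z wx wy ->
  [/\ has_partials f z, partial_x f z = wx & partial_y f z = wy].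
Proof.
move=> [[re_x im_x] [re_y im_y]]; split.
- split; [exact: (@ex_derive _ _ _ _ _ _ _ re_x)|exact: (@ex_derive _ _ _ _ _ _ _ im_x)|
    exact: (@ex_derive _ _ _ _ _ _ _ re_y)|exact: (@ex_derive _ _ _ _ _ _ _ im_y)].
- rewrite /partial_x !derive1E (@derive_val _ _ _ _ _ _ _ re_x).
  by rewrite (@derive_val _ _ _ _ _ _ _ im_x) -complex_eta.
- rewrite /partial_y !derive1E (@derive_val _ _ _ _ _ _ _ re_y).
  by rewrite (@derive_val _ _ _ _ _ _ _ im_y) -complex_eta.
Qed.

(** Nothing is known outside the upper half-plane: the horizontal line through z stays inside it,
    the vertical one does so near z. *)
Lemma partials_ext f g z wx wy : uhp z -> (forall z, uhp z -> f z = g z) ->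
  partials f z wx wy -> partials g z wx wy.
Proof.
move=> zH fg [hx hy]; split; [move: hx|move: hy]; apply: has_cderiv_near.
  by apply: (@filterE _ (nbhs (complex.Re z))) => t; exact: fg.
have : \forall t \near complex.Im z, 0 < t.
  exact: lt_nbhsr.
by apply: filterS => t t0; exact: fg.
Qed.

Lemma partialsD f g z wx wy wx' wy' : partials f z wx wy -> partials g z wx' wy' ->
  partials (fun z => f z + g z) z (wx + wx') (wy + wy').
Proof. by move=> [? ?] [? ?]; split; apply: has_cderivD. Qed.

Lemma partialsZ c f z wx wy : partials f z wx wy ->
  partials (fun z => c * f z) z (c * wx) (c * wy).
Proof. by move=> [? ?]; split; apply: has_cderivZ. Qed.

(** The maps z |-> (a z + b) / d of the Hecke operator, with al = a / d and be = b / d. *)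
Definition scale_shift (al be : R) z : R[i] := al%:C * z + be%:C.

Lemma scale_shiftE al be (x y : R) :
  scale_shift al be (x +i* y) = (al * x + be) +i* (al * y).
Proof.
by apply/eqP; rewrite eq_complex /= !mul0r subr0 !addr0 !eqxx.
Qed.

Lemma uhp_scale_shift al be z : 0 < al -> uhp z -> uhp (scale_shift al be z).
Proof. by case: z => x y al0; rewrite scale_shiftE /uhp /= => y0; exact: mulr_gt0. Qed.

Lemma partials_scale_shift al be f z wx wy : partials f (scale_shift al be z) wx wy ->
  partials (fun z => f (scale_shift al be z)) z (al%:C * wx) (al%:C * wy).
Proof.
case: z => x y; rewrite scale_shiftE => -[/= hx hy]; split.
  under [X in has_cderiv X]funext => t do rewrite scale_shiftE.
  exact: (has_cderiv_affine (u := fun s => f (s +i* (al * y)))).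
under [X in has_cderiv X]funext => t do rewrite scale_shiftE -[al * t]addr0.
apply: (has_cderiv_affine (u := fun s => f ((al * x + be) +i* s))).
by rewrite addr0.
Qed.

Lemma normc_ge_Im z : `|complex.Im z|%:C <= `|z|.
Proof.
by rewrite normc_def lecR -sqrtr_sqr ler_wsqrtr // lerDr sqr_ge0.
Qed.

Lemma near_uhp z : uhp z -> \forall w \near z, uhp w.
Proof.
rewrite {1}/uhp /= => zH; have zH' : 0 < (complex.Im z)%:C by rewrite ltcR.
have : \forall w \near z, `|z - w| < (complex.Im z)%:C.
  by move/cvgrPdist_lt : (@cvg_id _ (nbhs z)) => /(_ _ zH').
apply: filterS => w /(le_lt_trans (normc_ge_Im _)).
by rewrite ltcR raddfB /= /uhp /= ltr_norml => /andP[_]; lra.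
Qed.

Lemma continuous_ext_uhp f g : (forall z, uhp z -> f z = g z) ->
  (forall z, uhp z -> {for z, continuous f}) -> forall z, uhp z -> {for z, continuous g}.
Proof.
move=> fg fc z zH.
have gfz : \forall w \near z, f w = g w by apply: filterS (near_uhp zH) => w; exact: fg.
have -> : {for z, continuous g} = (g @ z --> f z) by rewrite /prop_for /continuous_at -fg.
exact: cvg_trans (near_eq_cvg gfz) (fc z zH).
Qed.

Lemma continuous_at_add f g z :
  {for z, continuous f} -> {for z, continuous g} -> {for z, continuous (fun w => f w + g w)}.
Proof. by move=> fc gc; exact: (cvgD fc gc). Qed.

Lemma continuous_at_scale c f z :
  {for z, continuous f} -> {for z, continuous (fun w => c * f w)}.
Proof. by move=> fc; exact: (cvgM (@cst_continuous R[i] R[i] c z) fc). Qed.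

Lemma continuous_scale_shift al be : continuous (scale_shift al be : R[i] -> R[i]).
Proof.
move=> z; apply: (continuous_at_add _ (@cst_continuous R[i] R[i] be%:C z)).
by apply: continuous_at_scale => A.
Qed.

(** Formulas for partial derivatives hold only on the upper half-plane; this lemma lets the
    inductions on n below use them under [classC]. *)
Lemma classC_ext n f g : (forall z, uhp z -> f z = g z) -> classC n f -> classC n g.
Proof.
elim: n f g => [|n IH] f g fg [fc fS].
  by split; [exact: continuous_ext_uhp fg fc|exact: I].
have [fp fx fy] := fS; split; first exact: continuous_ext_uhp fg fc.
have P z zH := partialsE (partials_ext zH fg (has_partialsP (fp z zH))).
split.
- by move=> z zH; have [gp _ _] := P z zH; exact: gp.
- by apply: IH fx => z zH; have [_ gx _] := P z zH; exact: esym gx.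
- by apply: IH fy => z zH; have [_ _ gy] := P z zH; exact: esym gy.
Qed.

Lemma classCD n f g : classC n f -> classC n g -> classC n (fun z => f z + g z).
Proof.
elim: n f g => [|n IH] f g [fc fS] [gc gS].
  split; last exact: I.
  by move=> z zH; apply: continuous_at_add; [exact: fc|exact: gc].
split; first by move=> z zH; apply: continuous_at_add; [exact: fc|exact: gc].
have [fp fx fy] := fS; have [gp gx gy] := gS.
have P z zH := partialsE (partialsD (has_partialsP (fp z zH)) (has_partialsP (gp z zH))).
split.
- by move=> z zH; have [h _ _] := P z zH; exact: h.
- by apply: classC_ext (IH _ _ fx gx) => z zH; have [_ h _] := P z zH; exact: esym h.
- by apply: classC_ext (IH _ _ fy gy) => z zH; have [_ _ h] := P z zH; exact: esym h.
Qed.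

Lemma classCZ n c f : classC n f -> classC n (fun z => c * f z).
Proof.
elim: n f => [|n IH] f [fc fS].
  split; last exact: I.
  by move=> z zH; apply: continuous_at_scale; exact: fc.
split; first by move=> z zH; apply: continuous_at_scale; exact: fc.
have [fp fx fy] := fS.
have P z zH := partialsE (partialsZ c (has_partialsP (fp z zH))).
split.
- by move=> z zH; have [h _ _] := P z zH; exact: h.
- by apply: classC_ext (IH _ fx) => z zH; have [_ h _] := P z zH; exact: esym h.
- by apply: classC_ext (IH _ fy) => z zH; have [_ _ h] := P z zH; exact: esym h.
Qed.

Lemma classC_scale_shift n al be f : 0 < al -> classC n f ->
  classC n (fun z => f (scale_shift al be z)).
Proof.
move=> al0; have sH z : uhp z -> uhp (scale_shift al be z) by exact: uhp_scale_shift.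
have cont g : (forall z, uhp z -> {for z, continuous g}) ->
    forall z, uhp z -> {for z, continuous (fun z => g (scale_shift al be z))}.
  move=> gc z zH; apply: continuous_comp; first exact: continuous_scale_shift.
  exact: gc (sH z zH).
elim: n f => [|n IH] f [fc fS]; first by split; [exact: cont fc|exact: I].
split; first exact: cont fc.
have [fp fx fy] := fS.
have P z zH := partialsE (partials_scale_shift (has_partialsP (fp _ (sH z zH)))).
split.
- by move=> z zH; have [h _ _] := P z zH; exact: h.
- by apply: classC_ext (classCZ _ (IH _ fx)) => z zH; have [_ h _] := P z zH; exact: esym h.
- by apply: classC_ext (classCZ _ (IH _ fy)) => z zH; have [_ _ h] := P z zH; exact: esym h.
Qed.

Definition laplace_eigen (k : nat) (la : R[i]) f : Prop :=
  forall z, uhp z -> laplacian k f z + la * f z = 0.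

Lemma laplace_eigenD k la f g : classC 2 f -> classC 2 g ->
  laplace_eigen k la f -> laplace_eigen k la g -> laplace_eigen k la (fun z => f z + g z).
Proof.
move=> [_ [fp [_ [fxp _ _]] [_ [fyp _ _]]]] [_ [gp [_ [gxp _ _]] [_ [gyp _ _]]]] Lf Lg z zH.
have P z' : uhp z' -> partials (fun z => f z + g z) z'
    (partial_x f z' + partial_x g z') (partial_y f z' + partial_y g z').
  by move=> z'H; exact: (partialsD (has_partialsP (fp _ z'H)) (has_partialsP (gp _ z'H))).
have Px z' : uhp z' -> partial_x f z' + partial_x g z' = partial_x (fun z => f z + g z) z'.
  by move=> z'H; have [_ hx hy] := partialsE (P _ z'H); exact: esym hx.
have Py z' : uhp z' -> partial_y f z' + partial_y g z' = partial_y (fun z => f z + g z) z'.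
  by move=> z'H; have [_ hx hy] := partialsE (P _ z'H); exact: esym hy.
have [_ xx _] := partialsE (partials_ext zH Px (partialsD (has_partialsP (fxp z zH)) (has_partialsP (gxp z zH)))).
have [_ _ yy] := partialsE (partials_ext zH Py (partialsD (has_partialsP (fyp z zH)) (has_partialsP (gyp z zH)))).
rewrite /laplacian xx yy -(Px z zH).
transitivity ((laplacian k f z + la * f z) + (laplacian k g z + la * g z)); last first.
  exact: etrans (congr2 +%R (Lf z zH) (Lg z zH)) (addr0 0).
rewrite /laplacian.
move: (partial_x f z) (partial_x g z) (f z) (g z) => fx gx fz gz.
move: (partial_x _ z) (partial_x _ z) (partial_y _ z) (partial_y _ z) => fxx gxx fyy gyy.
ring.
Qed.

Lemma laplace_eigenZ k la c f : classC 2 f ->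
  laplace_eigen k la f -> laplace_eigen k la (fun z => c * f z).
Proof.
move=> [_ [fp [_ [fxp _ _]] [_ [fyp _ _]]]] Lf z zH.
have P z' : uhp z' -> partials (fun z => c * f z) z' (c * partial_x f z') (c * partial_y f z').
  by move=> z'H; exact: (partialsZ c (has_partialsP (fp _ z'H))).
have Px z' : uhp z' -> c * partial_x f z' = partial_x (fun z => c * f z) z'.
  by move=> z'H; have [_ hx hy] := partialsE (P _ z'H); exact: esym hx.
have Py z' : uhp z' -> c * partial_y f z' = partial_y (fun z => c * f z) z'.
  by move=> z'H; have [_ hx hy] := partialsE (P _ z'H); exact: esym hy.
have [_ xx _] := partialsE (partials_ext zH Px (partialsZ c (has_partialsP (fxp z zH)))).
have [_ _ yy] := partialsE (partials_ext zH Py (partialsZ c (has_partialsP (fyp z zH)))).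
rewrite /laplacian xx yy -(Px z zH).
rewrite -[RHS](mulr0 c) -(Lf z zH) /laplacian; ring.
Qed.

(** Each derivative produces a factor al, which the scaling of y absorbs: the operators y^2 times a
    second derivative and y times a first derivative are invariant. *)
Lemma laplace_eigen_scale_shift k la al be f : 0 < al -> classC 2 f ->
  laplace_eigen k la f -> laplace_eigen k la (fun z => f (scale_shift al be z)).
Proof.
move=> al0 [_ [fp [_ [fxp _ _]] [_ [fyp _ _]]]] Lf z zH.
have sH z' : uhp z' -> uhp (scale_shift al be z') by exact: uhp_scale_shift.
have P z' : uhp z' -> partials (fun z => f (scale_shift al be z)) z'
    (al%:C * partial_x f (scale_shift al be z')) (al%:C * partial_y f (scale_shift al be z')).
  by move=> /sH z'H; exact: (partials_scale_shift (has_partialsP (fp _ z'H))).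
have Px z' : uhp z' -> al%:C * partial_x f (scale_shift al be z') =
    partial_x (fun z => f (scale_shift al be z)) z'.
  by move=> z'H; have [_ hx hy] := partialsE (P _ z'H); exact: esym hx.
have Py z' : uhp z' -> al%:C * partial_y f (scale_shift al be z') =
    partial_y (fun z => f (scale_shift al be z)) z'.
  by move=> z'H; have [_ hx hy] := partialsE (P _ z'H); exact: esym hy.
have [_ xx _] := partialsE (partials_ext zH Px
  (partialsZ al%:C (partials_scale_shift (has_partialsP (fxp _ (sH _ zH)))))).
have [_ _ yy] := partialsE (partials_ext zH Py
  (partialsZ al%:C (partials_scale_shift (has_partialsP (fyp _ (sH _ zH)))))).
have Imz : complex.Im (scale_shift al be z) = al * complex.Im z.
  by case: z {zH xx yy} => x y; rewrite scale_shiftE.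
rewrite /laplacian xx yy -(Px z zH).
rewrite -[RHS](Lf _ (sH _ zH)) /laplacian Imz !rmorphXn !rmorphM /=; ring.
Qed.

End Partials.

(** * Square integrability *)

Section PlaneMeasure.
Variable R : realType.
Local Notation lam := (@lebesgue_measure R).
Local Notation mu := (lam \x lam)%E.
Local Notation plane := (measurableTypeR R * measurableTypeR R)%type.

(** An open set is the union of the boxes with rational corners that it contains, a countable union
    of measurable rectangles. *)
Lemma open_measurable_plane (U : set (R * R)) : open U -> measurable (U : set plane).
Proof.
move=> oU.
pose box (a b c d : rat) : set plane := `]ratr a, ratr b[ `*` `]ratr c, ratr d[.
have -> : U = \bigcup_a \bigcup_b \bigcup_c \bigcup_d
    (if `[< box a b c d `<=` U >] then box a b c d else set0).
  apply/seteqP; split => [[x y] Uxy|[x y] [a _ [b _ [c _ [d _]]]]]; last first.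
    by case: asboolP => // boxU /boxU.
  have /nbhs_ballP[e /= e0 eU] := open_nbhs_nbhs (conj oU Uxy).
  have rat_lt (s t : R) : s < t -> exists q : rat, s < ratr q < t.
    by move=> /rat_in_itvoo[q]; rewrite in_itv /= => ?; exists q.
  have [a /andP[a1 a2]] := rat_lt (x - e) x ltac:(by rewrite ltrBlDr ltrDl).
  have [b /andP[b1 b2]] := rat_lt x (x + e) ltac:(by rewrite ltrDl).
  have [c /andP[c1 c2]] := rat_lt (y - e) y ltac:(by rewrite ltrBlDr ltrDl).
  have [d /andP[d1 d2]] := rat_lt y (y + e) ltac:(by rewrite ltrDl).
  exists a => //; exists b => //; exists c => //; exists d => //.
  case: asboolP => [_|[]]; first by split; rewrite /= in_itv /=; apply/andP.
  move=> [s t] [/=]; rewrite !in_itv /= => /andP[s1 s2] /andP[t1 t2].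
  by apply: eU; split; rewrite /ball /= ltr_distlC; apply/andP; split; lra.
apply: bigcupT_measurable_rat => a; apply: bigcupT_measurable_rat => b.
apply: bigcupT_measurable_rat => c; apply: bigcupT_measurable_rat => d.
by case: asboolP => // _; apply: measurableX; exact: measurable_itv.
Qed.

Lemma continuous_measurable_plane (D : set (R * R)) (h : R * R -> R) :
  open D -> (forall p, D p -> {for p, continuous h}) ->
  measurable_fun (D : set plane) (h : plane -> measurableTypeR R).
Proof.
move=> oD hc; apply: (measurability _ (RGenOpens.measurableE R)).
move=> _ [_ [a [b ->] <-]]; apply: open_measurable_plane.
rewrite openE => p [Dp hp]; apply: filterI; first exact: (open_nbhs_nbhs (conj oD Dp)).
by apply: hc => //; apply: open_nbhs_nbhs; split=> //; exact: interval_open.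
Qed.

Lemma measurable_plane_ge (g : R * R -> R) (c : R) : continuous g ->
  measurable ([set p | c <= g p] : set plane).
Proof.
move=> gc; rewrite (_ : [set p | _] = ~` (g @^-1` [set x | x < c])); last first.
  by apply/seteqP; split => p /=; rewrite leNgt => /negP.
apply: measurableC; apply: open_measurable_plane.
by apply: open_comp => // p _; exact: gc.
Qed.

Lemma measurable_affine (al be : R) :
  measurable_fun setT ((fun x => al * x + be) : measurableTypeR R -> measurableTypeR R).
Proof.
apply: continuous_measurable_fun => x; apply: cvgD; last exact: cvg_cst.
by apply: cvgM; [exact: cvg_cst|exact: cvg_id].
Qed.

(** Provides the pushforward as an abstract measure known through its values. *)
Lemma measure_preimage d d' (T : measurableType d) (T' : measurableType d')
    (m : {measure set T -> \bar R}) (f : T -> T') : measurable_fun setT f ->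
  exists m' : {measure set T' -> \bar R}, forall A, m' A = m (f @^-1` A).
Proof. by move=> mf; unshelve eexists (pushforward m f). Qed.

(** The pushforward multiplied by al gives half-open intervals their length, so it is Lebesgue
    measure by uniqueness. *)
Lemma lebesgue_affine_preimage (al be : R) (A : set R) : 0 < al -> measurable A ->
  lam ((fun x => al * x + be) @^-1` A) = (al^-1%:E * lam A)%E.
Proof.
move=> al0 mA.
have al_ge0 : 0 <= al by exact: ltW.
have [m mE'] := measure_preimage lam (measurable_affine al be).
have mE B : m B = lam ((fun x => al * x + be) @^-1` B) by exact: mE'.
have E : lam A = mscale (NngNum al_ge0) m A.
  apply: lebesgue_measure_unique => // _ [[a b] /= ab <-].
  rewrite /mscale /= mE.
  have -> : (fun x => al * x + be) @^-1` `]a, b] = `](a - be) / al, (b - be) / al]%classic.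
    apply/seteqP; split => x /=; rewrite !in_itv /= ltr_pdivrMr // ler_pdivlMr // => /andP[? ?];
      by apply/andP; split; rewrite mulrC; lra.
  have L (s t : R) : lam `]s, t]%classic = if s < t then (t - s)%:E else 0%E.
    by rewrite lebesgue_measure_itv /= lte_fin EFinB.
  rewrite !L ltr_pM2r ?invr_gt0 // ltrD2r.
  case: ifP => _; last by rewrite mule0.
  rewrite -EFinM; congr EFin; field; exact: lt0r_neq0.
rewrite E /mscale /= mE muleA -EFinM mulVf ?mul1e //; exact: lt0r_neq0.
Qed.

End PlaneMeasure.

(** * Affine change of variables in the plane *)

Section PlaneSubstitution.
Variable R : realType.
Local Notation lam := (@lebesgue_measure R).
Local Notation mu := (lam \x lam)%E.
Local Notation plane := (measurableTypeR R * measurableTypeR R)%type.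
Implicit Types (h : plane -> \bar R) (A B D : set plane).

Definition plane_affine (al be : R) (p : R * R) : R * R := (al * p.1 + be, al * p.2).

Lemma measurable_plane_affine al be :
  measurable_fun setT (plane_affine al be : plane -> plane).
Proof.
apply/measurable_fun_pairP; split.
  exact: (measurableT_comp (measurable_affine al be) measurable_fst).
rewrite (_ : snd \o _ = (fun x => al * x + 0) \o snd); last first.
  by apply/funext => p; rewrite /= addr0.
exact: (measurableT_comp (measurable_affine al 0) measurable_snd).
Qed.

(** The Jacobian is al^2: the pushforward multiplied by al^2 agrees with the product measure on
    rectangles, hence everywhere. *)
Lemma ge0_integral_plane_affine al be D h : 0 < al -> measurable D ->
  measurable_fun D h -> (forall p, D p -> 0 <= h p)%E ->
  (\int[mu]_(p in plane_affine al be @^-1` D) h (plane_affine al be p) =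
   (al ^- 2)%:E * \int[mu]_(p in D) h p)%E.
Proof.
move=> al0 mD mh h0.
have al2_ge0 : 0 <= al ^+ 2 by rewrite sqr_ge0.
have [m mE'] := measure_preimage mu (measurable_plane_affine al be).
have mE A : m A = mu (plane_affine al be @^-1` A) by exact: mE'.
have E : forall A, measurable A -> mu A = mscale (NngNum al2_ge0) m A.
  apply: product_measure_unique => A B mA mB.
  rewrite -[LHS]/((al ^+ 2)%:E * m (A `*` B))%E mE.
  have -> : plane_affine al be @^-1` (A `*` B) =
    ((fun x => al * x + be) @^-1` A) `*` ((fun x => al * x + 0) @^-1` B).
    by apply/seteqP; split => -[x y] /=; rewrite addr0.
  have mpre b C : measurable C -> measurable ((fun x => al * x + b) @^-1` C : set (measurableTypeR R)).
    by move=> mC; rewrite -[X in measurable X]setTI; exact: measurable_affine.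
  have P C C' : measurable C -> measurable C' -> mu (C `*` C') = (lam C * lam C')%E.
    by move=> mC mC'; exact: product_measure1E.
  rewrite P; [|exact: mpre..].
  rewrite !lebesgue_affine_preimage // muleACA.
  transitivity ((al ^+ 2 * (al^-1 * al^-1))%:E * (lam A * lam B))%E.
    by rewrite !EFinM -!muleA.
  by rewrite expr2 mulrACA mulfV ?lt0r_neq0 // mul1r mul1e.
have I : (\int[mu]_(p in D) h p = (al ^+ 2)%:E * \int[m]_(p in D) h p)%E.
  rewrite [LHS](eq_measure_integral (mscale (NngNum al2_ge0) m)).
    by rewrite ge0_integral_mscale.
  by move=> A mA _; exact: E.
have RE : ((al ^- 2)%:E * \int[mu]_(p in D) h p = \int[m]_(p in D) h p)%E.
  by rewrite I muleA -EFinM mulVf ?mul1e // expf_neq0 // lt0r_neq0.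
have h0' : {in D, forall p, (0 <= h p)%E} by move=> p; rewrite inE; exact: h0.
have P := @ge0_integral_pushforward _ _ plane plane R (plane_affine al be)
  (measurable_plane_affine al be) mu D h mD mh h0'.
have Q : (\int[pushforward mu (plane_affine al be : plane -> plane)]_(p in D) h p = \int[m]_(p in D) h p)%E.
  have -> : pushforward mu (plane_affine al be : plane -> plane) = m :> (set plane -> \bar R) by apply/funext => A; rewrite mE.
  by [].
exact: etrans (esym P) (etrans Q (esym RE)).
Qed.

End PlaneSubstitution.

(** * Finiteness of the norm on half-strips and on the fundamental domain *)

Section SquareIntegrable.
Variable R : realType.
Local Notation lam := (@lebesgue_measure R).
Local Notation mu := (lam \x lam)%E.
Local Notation plane := (measurableTypeR R * measurableTypeR R)%type.
Implicit Types (f g : R[i] -> R[i]) (A B : set plane) (z : R[i]).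

Lemma cabsC z : (cabs z)%:C = `|z|.
Proof. by rewrite /cabs normc_def. Qed.

Lemma cabs_ge0 z : 0 <= cabs z.
Proof. by rewrite -lecR cabsC normr_ge0. Qed.

Lemma cabsM z w : cabs (z * w) = cabs z * cabs w.
Proof. by apply: (@complexI R); rewrite rmorphM /= !cabsC normrM. Qed.

Lemma cabsD z w : cabs (z + w) <= cabs z + cabs w.
Proof. by rewrite -lecR rmorphD /= !cabsC ler_normD. Qed.

Lemma cabs_sub_le z w : `|cabs z - cabs w| <= cabs (z - w).
Proof.
have H (a b : R[i]) : cabs a - cabs b <= cabs (a - b).
  by rewrite lerBlDr; have := cabsD (a - b) b; rewrite subrK.
have N (a b : R[i]) : cabs (a - b) = cabs (b - a).
  by apply: (@complexI R); rewrite !cabsC distrC.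
by rewrite ler_norml H andbT lerNl opprB N H.
Qed.

Lemma cabs_le_Re_Im (x y : R) : cabs (x +i* y) <= `|x| + `|y|.
Proof.
rewrite /cabs normc_def /=.
rewrite -(ler_pXn2r (n := 2)) ?nnegrE ?sqrtr_ge0 ?addr_ge0 // sqr_sqrtr ?addr_ge0 ?sqr_ge0 //.
rewrite -(real_normK (num_real x)) -(real_normK (num_real y)).
have := normr_ge0 x; have := normr_ge0 y; nra.
Qed.

Lemma complex_pos (e : R[i]) : 0 < e -> e = (complex.Re e)%:C /\ 0 < complex.Re e.
Proof.
move=> e0; have er : e = (complex.Re e)%:C by rewrite RRe_real // gtr0_real.
by split=> //; move: e0; rewrite {1}er ltcR.
Qed.

Lemma continuous_mk_complex : continuous (fun p : R * R => p.1 +i* p.2).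
Proof.
move=> [x y]; apply/cvgrPdist_lt => e /complex_pos[-> e0].
have e2 : 0 < complex.Re e / 2 by rewrite divr_gt0.
apply: filterS (nbhsx_ballx ((x, y) : R * R) _ e2) => -[s t] [/= hs ht].
rewrite -cabsC ltcR -[_ - _]/((x - s) +i* (y - t)).
apply: le_lt_trans (cabs_le_Re_Im _ _) _.
by move: hs ht; rewrite /ball /=; lra.
Qed.

Lemma continuous_cabs : continuous (@cabs R).
Proof.
move=> z; apply/(@cvgrPdist_lt R R R[i] (nbhs z) (nbhs_filter z)) => e e0.
have eC : 0 < e%:C by rewrite ltcR.
have : \forall w \near z, `|z - w| < e%:C.
  by move/cvgrPdist_lt : (@cvg_id _ (nbhs z)) => /(_ _ eC).
move=> zw; suff : \forall w \near z, `|cabs z - cabs w| < e by [].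
by apply: filterS zw => w; rewrite -cabsC ltcR; apply: le_lt_trans; exact: cabs_sub_le.
Qed.

Definition upper_plane : set plane := [set p | 0 < p.2].

Lemma open_upper_plane : open (upper_plane : set (R * R)).
Proof.
rewrite (_ : upper_plane = snd @^-1` [set x | 0 < x]) //.
by apply: open_comp => // p _; exact: cvg_snd.
Qed.

Definition density f (p : plane) : R := cabs (f (p.1 +i* p.2)) ^+ 2 / p.2 ^+ 2.

Lemma density_ge0 f p : 0 <= density f p.
Proof. by rewrite divr_ge0 ?sqr_ge0. Qed.

Definition continuous_uhp f : Prop := forall z, uhp z -> {for z, continuous f}.

Lemma continuous_density f (p : R * R) : continuous_uhp f -> upper_plane p ->
  {for p, continuous (density f : R * R -> R)}.
Proof.
move=> fc p0.
have c1 : {for p, continuous (fun p : R * R => cabs (f (p.1 +i* p.2)))}.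
  apply: continuous_comp; last exact: continuous_cabs.
  by apply: continuous_comp; [exact: continuous_mk_complex|exact: fc].
have c2 : {for p, continuous (fun p : R * R => p.2 ^- 2)}.
  have s : {for p, continuous (snd : R * R -> R)} by exact: cvg_snd.
  apply: continuous_comp; first exact: (cvgM s s).
  by apply: inv_continuous; rewrite mulf_neq0 // gt_eqF.
exact: (cvgM (cvgM c1 c1) c2).
Qed.

Lemma measurable_density f : continuous_uhp f ->
  measurable_fun upper_plane (fun p => (density f p)%:E).
Proof.
move=> fc; apply/measurable_EFinP; apply: continuous_measurable_plane.
  exact: open_upper_plane.
by move=> p; exact: continuous_density.
Qed.


Definition finite_density f A : Prop :=
  (\int[mu]_(p in A) (density f p)%:E < +oo)%E.

Lemma measurable_fundamental_domain : measurable (@fundamental_domain R : set plane).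
Proof.
have -> : @fundamental_domain R = upper_plane `&` ([set p | - 2^-1 <= - `|p.1|] `&`
    [set p | 1 <= p.1 ^+ 2 + p.2 ^+ 2]).
  by apply/seteqP; split => [p [? ? ?]|p [? [/= + ?]]]; rewrite /= lerN2; split.
have cx : continuous (fst : R * R -> R) by move=> p; exact: cvg_fst.
have cy : continuous (snd : R * R -> R) by move=> p; exact: cvg_snd.
apply: measurableI; first by apply: open_measurable_plane; exact: open_upper_plane.
apply: measurableI; apply: measurable_plane_ge => p.
  by apply: cvgN; apply: cvg_norm; exact: cx.
exact: (cvgD (cvgM (cx p) (cx p)) (cvgM (cy p) (cy p))).
Qed.

Section FiniteDensity.
Variable f : R[i] -> R[i].
Hypothesis fc : continuous_uhp f.

Let mdens A : A `<=` upper_plane -> measurable A ->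
  measurable_fun A (fun p => (density f p)%:E).
Proof.
move=> AU mA; apply: measurable_funS (measurable_density fc) => //.
by apply: open_measurable_plane; exact: open_upper_plane.
Qed.

Let dens0 A p : A p -> (0 <= (density f p)%:E)%E.
Proof. by move=> _; rewrite lee_fin density_ge0. Qed.

Lemma finite_densityS A B : measurable A -> measurable B -> A `<=` B -> B `<=` upper_plane ->
  finite_density f B -> finite_density f A.
Proof.
move=> mA mB AB BU; apply: le_lt_trans.
by apply: ge0_subset_integral => //; [exact: mdens|exact: dens0].
Qed.

Lemma finite_densityU A B : measurable A -> measurable B ->
  A `<=` upper_plane -> B `<=` upper_plane ->
  finite_density f A -> finite_density f B -> finite_density f (A `|` B).
Proof.
move=> mA mB AU BU fA fB.
have -> : A `|` B = A `|` (B `\` A).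
  apply/seteqP; split => p [Ap|]; try by left.
    by move=> Bp; have [Ap|nAp] := pselect (A p); [left|right].
  by case=> Bp _; right.
have mBA : measurable (B `\` A) by exact: measurableD.
have BAU : B `\` A `<=` upper_plane by move=> p [/BU].
have fBA : finite_density f (B `\` A) by apply: (finite_densityS mBA mB) => // p [].
rewrite /finite_density ge0_integral_setU //.
- exact: lte_add_pinfty.
- by apply: mdens; [move=> p [/AU|/BAU]|exact: measurableU].
- by move=> p _; rewrite lee_fin density_ge0.
- by apply/disj_setPS => p [Ap [_]].
Qed.

Definition half_strip (x1 x2 y : R) : set plane := `[x1, x2] `*` `[y, +oo[.

Lemma measurable_half_strip x1 x2 y : measurable (half_strip x1 x2 y).
Proof. by apply: measurableX; exact: measurable_itv. Qed.

Lemma half_strip_upper x1 x2 y : 0 < y -> half_strip x1 x2 y `<=` upper_plane.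
Proof.
by move=> y0 [s t] [_ /=]; rewrite in_itv /= andbT; apply: lt_le_trans.
Qed.

(** The density is continuous on a compact box at positive height, hence bounded, and the box has
    finite area. *)
Lemma finite_density_box x1 x2 y1 y2 : 0 < y1 ->
  finite_density f (`[x1, x2] `*` `[y1, y2]).
Proof.
move=> y10; set B := _ `*` _.
have mB : measurable B by apply: measurableX; exact: measurable_itv.
have BU : B `<=` upper_plane.
  by move=> [s t] [_ /=]; rewrite in_itv /= => /andP[+ _]; apply: lt_le_trans.
(* The empty box is separate, as it has no maximum. *)
have [B0|/set0P/negP/negPn/eqP ->] := pselect (B !=set0); last first.
  by rewrite /finite_density integral_set0.
have cB : compact (B : set (R * R)) by apply: compact_setX; exact: segment_compact.
have wB : {within (B : set (R * R)), continuous (density f : R * R -> R)}.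
  apply: continuous_in_subspaceT => p; rewrite inE => Bp.
  by apply: continuous_density => //; exact: BU.
have [c _ cmax] := compact_EVT_max B0 cB wB.
apply: (@le_lt_trans _ _ (\int[mu]_(p in B) (cst (density f c)%:E) p)%E).
  apply: ge0_le_integral => //.
  - exact: dens0.
  - exact: mdens.
  - by move=> p Bp; rewrite lee_fin; apply: cmax; rewrite inE.
rewrite integral_cst //.
have L (s t : R) : lam `[s, t]%classic = if s < t then (t - s)%:E else 0%E.
  by rewrite lebesgue_measure_itv /= lte_fin EFinB.
have muB : mu B = (lam `[x1, x2]%classic * lam `[y1, y2]%classic)%E by exact: product_measure1E.
rewrite [X in (_ * X)%E]muB !L; do 2 case: ifP => _; rewrite ?(mule0, mul0e) ?ltry //.
Qed.

Hypothesis fper : forall z, uhp z -> cabs (f (z + 1)) = cabs (f z).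

Lemma finite_density_shift x1 x2 y : 0 < y ->
  finite_density f (half_strip (x1 + 1) (x2 + 1) y) <-> finite_density f (half_strip x1 x2 y).
Proof.
move=> y0; rewrite /finite_density.
have E := @ge0_integral_plane_affine R 1 1 (half_strip (x1 + 1) (x2 + 1) y)
  (fun p => (density f p)%:E) ltr01 (measurable_half_strip _ _ _)
  (mdens (half_strip_upper y0) (measurable_half_strip _ _ _)) (@dens0 _).
rewrite expr1n invr1 mul1e in E.
have pre : plane_affine 1 1 @^-1` half_strip (x1 + 1) (x2 + 1) y = half_strip x1 x2 y.
  by apply/seteqP; split => -[s t]; rewrite /plane_affine /half_strip /= !mul1r !in_itv /= !lerD2r.
rewrite pre in E; rewrite -E.
suff -> : (\int[mu]_(p in half_strip x1 x2 y) (density f (plane_affine 1 1 p))%:E =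
  \int[mu]_(p in half_strip x1 x2 y) (density f p)%:E)%E by [].
apply: eq_integral => -[s t]; rewrite inE => /(half_strip_upper y0) /= t0.
have e : (s + 1) +i* t = (s +i* t) + 1.
  by apply/eqP; rewrite eq_complex /= addr0 !eqxx.
by rewrite /density /plane_affine /= !mul1r e fper.
Qed.

(** The wide strip is covered by the unit strips centred at - n, ..., n, all translates of the
    central one; each induction step adds one on either side. *)
Lemma finite_density_wide (n : nat) : finite_density f (half_strip (- 2^-1) 2^-1 1) ->
  finite_density f (half_strip (- (n%:R + 2^-1)) (n%:R + 2^-1) 1).
Proof.
move=> f0.
have right (k : nat) : finite_density f (half_strip (k%:R - 2^-1) (k%:R + 2^-1) 1).
  elim: k => [|k IH]; first by rewrite !add0r.
  have -> : k.+1%:R - 2^-1 = (k%:R - 2^-1) + 1 :> R by rewrite -natr1; ring.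
  have -> : k.+1%:R + 2^-1 = (k%:R + 2^-1) + 1 :> R by rewrite -natr1; ring.
  by apply/finite_density_shift.
have left (k : nat) : finite_density f (half_strip (- k%:R - 2^-1) (- k%:R + 2^-1) 1).
  elim: k => [|k IH]; first by rewrite oppr0 !add0r.
  have [h _] := finite_density_shift (- k.+1%:R - 2^-1) (- k.+1%:R + 2^-1) ltr01.
  apply: h.
  have -> : - k.+1%:R - 2^-1 + 1 = (- k%:R - 2^-1) :> R by rewrite -natr1; ring.
  by have -> : - k.+1%:R + 2^-1 + 1 = (- k%:R + 2^-1) :> R by rewrite -natr1; ring.
elim: n => [|n IH]; first by rewrite add0r.
have U1 x1 x2 : half_strip x1 x2 1 `<=` upper_plane by exact: half_strip_upper.
have m1 := measurable_half_strip.
pose S := half_strip (- (n%:R + 2^-1)) (n%:R + 2^-1) 1 `|`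
  (half_strip (n.+1%:R - 2^-1) (n.+1%:R + 2^-1) 1 `|` half_strip (- n.+1%:R - 2^-1) (- n.+1%:R + 2^-1) 1).
have US : S `<=` upper_plane by move=> p [/U1|[/U1|/U1]].
have mS : measurable S by do 2 (apply: measurableU => //).
apply: (finite_densityS (B := S)) => //.
  move=> [s t] [/=]; rewrite !in_itv /= !andbT -natr1 => /andP[s1 s2] t1.
  have [sn|sn] := lerP s (- (n%:R + 2^-1)).
    right; right; split; rewrite /= in_itv /= ?andbT // -natr1; apply/andP; split; lra.
  have [sn'|sn'] := lerP s (n%:R + 2^-1).
    by left; split; rewrite /= in_itv /= ?andbT // sn' ltW.
  by right; left; split; rewrite /= in_itv /= ?andbT // -natr1; apply/andP; split; lra.
apply: finite_densityU => //.
- by apply: measurableU.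
- by move=> p [/U1|/U1].
- exact: finite_densityU.
Qed.

(** The half-strip is cut at height 1 into a compact box and a cuspidal part. *)
Lemma finite_density_half_strip (n : nat) y : 0 < y ->
  finite_density f (half_strip (- 2^-1) 2^-1 1) ->
  finite_density f (half_strip (- (n%:R + 2^-1)) (n%:R + 2^-1) y).
Proof.
move=> y0 f0.
pose B := `[- (n%:R + 2^-1), n%:R + 2^-1]%classic `*` `[y, 1]%classic : set plane.
have mB : measurable B by apply: measurableX; exact: measurable_itv.
have BU : B `<=` upper_plane.
  by move=> [s t] [_ /=]; rewrite in_itv /= => /andP[+ _]; apply: lt_le_trans.
have U1 := @half_strip_upper (- (n%:R + 2^-1)) (n%:R + 2^-1) 1 ltr01.
have m1 := measurable_half_strip.
apply: (finite_densityS (B := B `|` half_strip (- (n%:R + 2^-1)) (n%:R + 2^-1) 1)) => //.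
- exact: measurableU.
- move=> [s t] [/= hs]; rewrite in_itv /= andbT => yt.
  have [t1|t1] := lerP t 1; first by left; split; rewrite //= in_itv /= yt.
  by right; split; rewrite //= in_itv /= andbT ltW.
- by move=> p [/BU|/U1].
- by apply: finite_densityU => //; [exact: finite_density_box|exact: finite_density_wide].
Qed.

(** The strip |x| <= 1/2, y >= 1 is contained in the fundamental domain. *)
Lemma finite_density_cusp : finite_density f (@fundamental_domain R) ->
  forall n y, 0 < y -> finite_density f (half_strip (- (n%:R + 2^-1)) (n%:R + 2^-1) y).
Proof.
move=> fF n y y0; apply: finite_density_half_strip => //.
apply: finite_densityS fF => //.
- exact: measurable_half_strip.
- exact: measurable_fundamental_domain.
- move=> [s t] [/=]; rewrite !in_itv /= andbT => s1 t1.
  by rewrite /fundamental_domain /= ler_norml s1; split => //; [lra|nra].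
- by move=> p [].
Qed.

End FiniteDensity.

Lemma square_integrableE f : square_integrable f = finite_density f (@fundamental_domain R).
Proof. by []. Qed.

Lemma fundamental_domain_half_strip : @fundamental_domain R `<=` half_strip (- 2^-1) 2^-1 2^-1.
Proof.
move=> [s t] [/= t0 + st]; rewrite ler_norml => /andP[s1 s2].
split; rewrite /= in_itv /= ?s1 ?s2 // andbT.
(* With |s| <= 1/2 and 0 < t < 1/2 the sum of squares would be below 1. *)
rewrite leNgt; apply/negP => t2; nra.
Qed.

(** After the substitution the integral runs over the image of the fundamental domain, which lies in
    a half-strip at height al / 2. *)
Lemma square_integrable_scale_shift al be f : 0 < al -> continuous_uhp f ->
  (forall z, uhp z -> cabs (f (z + 1)) = cabs (f z)) ->
  square_integrable f -> square_integrable (fun z => f (scale_shift al be z)).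
Proof.
move=> al0 fc fper fF; rewrite square_integrableE.
have al2 : 0 < al / 2 by rewrite divr_gt0.
(* Large enough for |al x + be| <= n + 1/2 whenever |x| <= 1/2. *)
pose n := Num.bound (al + `|be|).
have nb : al + `|be| < n%:R.
  by apply: le_lt_trans (archi_boundP _); rewrite ?ler_norm // addr_ge0 // ltW.
pose B := half_strip (- (n%:R + 2^-1)) (n%:R + 2^-1) (al / 2).
have mB : measurable B by exact: measurable_half_strip.
have BU : B `<=` upper_plane by exact: half_strip_upper.
have fB : finite_density f B by exact: finite_density_cusp.
have mU : measurable upper_plane by apply: open_measurable_plane; exact: open_upper_plane.
have md : measurable_fun B (fun p => (density f p)%:E).
  exact: measurable_funS (measurable_density fc).
have gc : continuous_uhp (fun z => f (scale_shift al be z)).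
  move=> z zH; apply: continuous_comp; first exact: continuous_scale_shift.
  by apply: fc; exact: uhp_scale_shift.
(* The factor al^2 compensates for the denominator (al y)^2 of the density at the image point. *)
pose h := fun p : plane => ((al ^+ 2)%:E * (density f p)%:E)%E.
have E := @ge0_integral_plane_affine R al be B h al0 mB.
have mh : measurable_fun B h by apply: measurable_funeM.
have h0 p : B p -> (0 <= h p)%E.
  by move=> _; rewrite /h -EFinM lee_fin mulr_ge0 ?sqr_ge0 ?density_ge0.
have {}E := E mh h0.
have preU : plane_affine al be @^-1` B `<=` upper_plane.
  move=> p /BU; rewrite /upper_plane /plane_affine /=.
  by rewrite pmulr_rgt0.
have mpre : measurable (plane_affine al be @^-1` B : set plane).
  by rewrite -[X in measurable X]setTI; exact: measurable_plane_affine.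
apply: (finite_densityS gc measurable_fundamental_domain mpre _ preU).
  move=> p /fundamental_domain_half_strip; case: p => s t [/=].
  rewrite !in_itv /= !andbT => /andP[s1 s2] t1.
  have := ler_norm be; have := ler_norm (- be); rewrite normrN => b1 b2.
  by split; rewrite /= in_itv /= ?andbT; [apply/andP; split|]; nra.
rewrite /finite_density.
have -> : (\int[mu]_(p in plane_affine al be @^-1` B)
    (density (fun z => f (scale_shift al be z)) p)%:E =
    \int[mu]_(p in plane_affine al be @^-1` B) h (plane_affine al be p))%E.
  apply: eq_integral => -[s t]; rewrite inE => /preU /= t0.
  rewrite /h /density -EFinM; congr EFin; rewrite scale_shiftE /plane_affine /=.
  move: (cabs _) => c; field.
  by rewrite !gt_eqF.
rewrite E /h ge0_integralZl_EFin ?sqr_ge0 //; last by move=> p _; rewrite lee_fin density_ge0.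
have al2_ge0 : (0 <= (al ^+ 2)%:E)%E by rewrite lee_fin sqr_ge0.
apply: lte_mul_pinfty; rewrite ?lee_fin ?invr_ge0 ?sqr_ge0 //.
exact: lte_mul_pinfty.
Qed.

Lemma square_integrableZ c f : continuous_uhp f -> square_integrable f ->
  square_integrable (fun z => c * f z).
Proof.
move=> fc; rewrite !square_integrableE => fF.
have mF := measurable_fundamental_domain.
have mU : measurable upper_plane by apply: open_measurable_plane; exact: open_upper_plane.
have FU : @fundamental_domain R `<=` upper_plane by move=> p [].
have md : measurable_fun (@fundamental_domain R : set plane) (fun p => (density f p)%:E).
  exact: measurable_funS (measurable_density fc).
rewrite /finite_density.
under eq_integral do rewrite /density cabsM exprMn -mulrA EFinM.
rewrite ge0_integralZl_EFin //; last 2 first.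
- by move=> p _; rewrite lee_fin density_ge0.
- by rewrite sqr_ge0.
by apply: lte_mul_pinfty => //; rewrite ?lee_fin ?sqr_ge0.
Qed.

(** Follows from |a + b|^2 <= 2 |a|^2 + 2 |b|^2. *)
Lemma square_integrableD f g : continuous_uhp f -> continuous_uhp g ->
  square_integrable f -> square_integrable g -> square_integrable (fun z => f z + g z).
Proof.
move=> fc gc; rewrite !square_integrableE => fF gF.
have mF := measurable_fundamental_domain.
have mU : measurable upper_plane by apply: open_measurable_plane; exact: open_upper_plane.
have FU : @fundamental_domain R `<=` upper_plane by move=> p [].
have md u : continuous_uhp u -> measurable_fun (@fundamental_domain R : set plane) (fun p => (density u p)%:E).
  by move=> uc; exact: measurable_funS (measurable_density uc).
have fgc : continuous_uhp (fun z => f z + g z).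
  by move=> z zH; apply: continuous_at_add; [exact: fc|exact: gc].
have e0 u (p : plane) : (0 <= 2%:E * (density u p)%:E)%E.
  by rewrite -EFinM lee_fin mulr_ge0 // density_ge0.
apply: (@le_lt_trans _ _ (\int[mu]_(p in @fundamental_domain R)
    (2%:E * (density f p)%:E + 2%:E * (density g p)%:E))%E).
  apply: ge0_le_integral => //.
  - by move=> p _; rewrite lee_fin density_ge0.
  - exact: md.
  - by apply: emeasurable_funD; apply: measurable_funeM; exact: md.
  - move=> p [p0 _ _]; rewrite -!EFinM -EFinD lee_fin /density !mulrA -mulrDl.
    rewrite ler_pM2r ?invr_gt0 ?exprn_gt0 //.
    have := cabsD (f (p.1 +i* p.2)) (g (p.1 +i* p.2)).
    have := cabs_ge0 (f (p.1 +i* p.2) + g (p.1 +i* p.2)).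
    move: (cabs (f _ + g _)) (cabs (f _)) (cabs (g _)) => c a b c0 cab.
    apply: (@le_trans _ _ ((a + b) ^+ 2)); first by rewrite ler_sqr ?nnegrE // (le_trans c0).
    by have := sqr_ge0 (a - b); rewrite !expr2; lra.
rewrite ge0_integralD //; last 2 first.
- by apply: measurable_funeM; exact: md.
- by apply: measurable_funeM; exact: md.
have d0 u (p : plane) : @fundamental_domain R p -> (0 <= (density u p)%:E)%E.
  by move=> _; rewrite lee_fin density_ge0.
rewrite !ge0_integralZl_EFin //; [|exact: d0|exact: md|exact: d0|exact: md].
by apply: lte_add_pinfty; apply: lte_mul_pinfty => //; rewrite lee_fin.
Qed.

End SquareIntegrable.

(** * Fourier expansions *)

Section UnconditionalSums.
Variable R : realType.
Implicit Types (u v : int -> R[i]) (s : R[i]) (A B : seq int).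

(* Unconditional convergence; unlike the symmetric partial sums of [sums_to], it
   is visibly invariant under a change of the summation index. *)
Definition asum u s : Prop :=
  (exists M : R, forall B, uniq B -> \sum_(n <- B) cabs (u n) <= M) /\
  (forall e : R, 0 < e -> exists A, forall B, uniq B -> {subset A <= B} ->
    cabs (\sum_(n <- B) u n - s) <= e).

Lemma cabs0 : cabs (0 : R[i]) = 0.
Proof. by apply: (@complexI R); rewrite cabsC normr0. Qed.

Lemma cabs_sum (B : seq int) (P : pred int) u :
  cabs (\sum_(n <- B | P n) u n) <= \sum_(n <- B | P n) cabs (u n).
Proof.
elim/big_rec2: _ => [|n x y _ h]; first by rewrite cabs0.
by apply: le_trans (cabsD _ _) _; rewrite lerD2l.
Qed.

Lemma cabsN z : cabs (- z : R[i]) = cabs z.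
Proof. by apply: (@complexI R); rewrite !cabsC normrN. Qed.

Lemma big_seq_sub (V : zmodType) (F : int -> V) B W : uniq B -> uniq W ->
  \sum_(n <- B) F n - \sum_(n <- W) F n =
  \sum_(n <- B | n \notin W) F n - \sum_(n <- W | n \notin B) F n.
Proof.
move=> uB uW; rewrite (bigID (mem W)) [X in _ - X](bigID (mem B)) /=.
rewrite -(big_filter B (mem W)) -(big_filter W (mem B)).
have -> : \sum_(n <- [seq n <- W | n \in B]) F n = \sum_(n <- [seq n <- B | n \in W]) F n.
  apply: perm_big; apply: uniq_perm; rewrite ?filter_uniq // => n.
  by rewrite !mem_filter andbC.
by rewrite opprD addrACA subrr add0r.
Qed.

(** If the sum over A is within e of the supremum of all finite sums, a set disjoint from A can add
    at most e. *)
Lemma bounded_tail u (M : R) : (forall B, uniq B -> \sum_(n <- B) cabs (u n) <= M) ->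
  forall e : R, 0 < e -> exists2 A, uniq A & forall B, uniq B ->
    {in B, forall n, n \notin A} -> \sum_(n <- B) cabs (u n) <= e.
Proof.
move=> uM e e0.
pose S := [set x | exists2 B, uniq B & x = \sum_(n <- B) cabs (u n)].
have supS : has_sup S.
  by split; [exists 0, [::]; rewrite // big_nil|exists M => _ [B uB ->]; exact: uM].
have [_ [A uA ->] hA] := sup_adherent e0 supS.
exists A => // B uB BA; have uAB : uniq (A ++ B).
  by rewrite cat_uniq uA uB andbT /= -all_predC; apply/allP => n /BA.
have : \sum_(n <- A ++ B) cabs (u n) <= sup S by apply: sup_ubound supS.2 _ _; exists (A ++ B).
by rewrite big_cat /=; move: hA; lra.
Qed.

(** The indices of the symmetric partial sums in [sums_to]. *)
Definition window (N : nat) : seq int := [seq j%:Z - N%:Z | j <- iota 0 N.*2.+1].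

Lemma window_sum (V : nmodType) (F : int -> V) N :
  \sum_(0 <= j < N.*2.+1) F (j%:Z - N%:Z) = \sum_(n <- window N) F n.
Proof. by rewrite big_map /index_iota subn0. Qed.

Lemma window_uniq N : uniq (window N).
Proof. by rewrite map_inj_uniq ?iota_uniq // => x y; lia. Qed.

Lemma mem_window N (n : int) : (n \in window N) = (`|n|%N <= N)%N.
Proof.
apply/mapP/idP => [[j]|nN]; first by rewrite mem_iota; lia.
exists (absz (n + Posz N)); last by lia.
by rewrite mem_iota; lia.
Qed.

Lemma sub_window A : exists N0, forall N, (N0 <= N)%N -> {subset A <= window N}.
Proof.
exists (\max_(n <- A) `|n|%N) => N hN n nA; rewrite mem_window (leq_trans _ hN) //.
by rewrite (big_rem n) //= leq_maxl.
Qed.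

(** A finite set containing A and a large window differ only in terms outside A, which contribute at
    most e / 2; the window sum is within e / 2 of s. *)
Lemma sums_to_asum u s : sums_to u s -> asum u s.
Proof.
move=> [ufin ulim].
have [M uM] : exists M : R, forall B, uniq B -> \sum_(n <- B) cabs (u n) <= M.
  exists (fine (\esum_(n in [set: int]) (cabs (u n))%:E)) => B uB.
  have u0 : (0 <= \esum_(n in [set: int]) (cabs (u n))%:E)%E.
    by apply: esum_ge0 => n _; rewrite lee_fin cabs_ge0.
  rewrite -lee_fin fineK ?ge0_fin_numE // -sumEFin; apply: esum_ge.
  exists [set` B]; first (split; [exact: finite_seq|by []]).
  by rewrite fsbig_seq.
split; first by exists M.
move=> e e0; have e2 : 0 < e / 2 by rewrite divr_gt0.
have [A uA tailA] := bounded_tail uM e2; exists A => B uB AB.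
have [N0 hN0] := sub_window A.
have e2C : 0 < (e / 2)%:C by rewrite ltcR.
move/cvgrPdist_le : ulim => /(_ _ e2C) [N1 _ hN1].
pose N := maxn N0 N1.
have := hN1 N (leq_maxr _ _); rewrite window_sum -cabsC lecR => dN.
have AW : {subset A <= window N} by apply: hN0; exact: leq_maxl.
have -> : \sum_(n <- B) u n - s = (\sum_(n <- B) u n - \sum_(n <- window N) u n) -
   (s - \sum_(n <- window N) u n) by ring.
apply: le_trans (cabsD _ _) _; rewrite cabsN [leRHS](splitr e) lerD //.
rewrite big_seq_sub ?window_uniq //; apply: le_trans (cabsD _ _) _; rewrite cabsN.
apply: le_trans (lerD (cabs_sum _ _ _) (cabs_sum _ _ _)) _.
rewrite -!(big_filter _ (fun n => n \notin _)) -big_cat; apply: tailA.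
  rewrite cat_uniq; apply/and3P; split; rewrite ?filter_uniq ?window_uniq //.
  rewrite -all_predC; apply/allP => n; rewrite mem_filter => /andP[nB _].
  by rewrite /= mem_filter (negPf nB) andbF.
move=> n; rewrite mem_cat !mem_filter => /orP[/andP[nW _]|/andP[nB _]].
  by apply: contra nW; exact: AW.
by apply: contra nB; exact: AB.
Qed.

Lemma asum_sums_to u s : asum u s -> sums_to u s.
Proof.
move=> [[M uM] us]; split.
  apply: (@le_lt_trans _ _ M%:E); last exact: ltry.
  apply: ub_ereal_sup => _ [X [fX _] <-].
  by rewrite fsbig_finite //= sumEFin lee_fin; apply: uM; exact: finmap.fset_uniq.
apply/cvgrPdist_le => e /complex_pos[-> e0].
have [A hA] := us _ e0; have [N0 hN0] := sub_window A.
exists N0 => // N /= N0N; rewrite window_sum -cabsC lecR -cabsN opprB.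
by apply: hA; [exact: window_uniq|exact: hN0].
Qed.

Lemma asum_ext u v s : u =1 v -> asum u s -> asum v s.
Proof. by move=> /funext ->. Qed.

Lemma asum0 : asum (fun=> 0) 0.
Proof.
split; first by exists 0 => B _; rewrite big1 // => n _; exact: cabs0.
by move=> e e0; exists [::] => B _ _; rewrite big1 // subr0 cabs0 ltW.
Qed.

Lemma asumD u v s t : asum u s -> asum v t -> asum (fun n => u n + v n) (s + t).
Proof.
move=> [[M uM] us] [[M' vM] vt]; split.
  exists (M + M') => B uB; apply: le_trans (lerD (uM _ uB) (vM _ uB)).
  by rewrite -big_split ler_sum // => n _; exact: cabsD.
move=> e e0; have e2 : 0 < e / 2 by rewrite divr_gt0.
have [A hA] := us _ e2; have [A' hA'] := vt _ e2.
exists (A ++ A') => B uB AB; rewrite big_split /= opprD addrACA [leRHS](splitr e).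
apply: le_trans (cabsD _ _) (lerD (hA _ uB _) (hA' _ uB _)) => n nA; apply: AB;
  by rewrite mem_cat nA ?orbT.
Qed.

Lemma asumZ c u s : asum u s -> asum (fun n => c * u n) (c * s).
Proof.
move=> [[M uM] us]; split.
  exists (cabs c * M) => B uB; rewrite (eq_bigr (fun n => cabs c * cabs (u n))); last first.
    by move=> n _; rewrite cabsM.
  by rewrite -mulr_sumr ler_wpM2l ?cabs_ge0 ?uM.
(* Adding 1 avoids division by zero when c = 0. *)
move=> e e0; have c1 : 0 < cabs c + 1 by rewrite ltr_wpDl ?cabs_ge0.
have e2 : 0 < e / (cabs c + 1) by rewrite divr_gt0.
have [A hA] := us _ e2; exists A => B uB AB.
rewrite -mulr_sumr -mulrBr cabsM; apply: le_trans (ler_wpM2l (cabs_ge0 c) (hA _ uB AB)) _.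
by rewrite mulrCA ger_pMr // ler_pdivrMr // mul1r lerDl.
Qed.

Lemma asum_sum (I : Type) (r : seq I) (P : pred I) (u : I -> int -> R[i]) (s : I -> R[i]) :
  (forall i, P i -> asum (u i) (s i)) ->
  asum (fun n => \sum_(i <- r | P i) u i n) (\sum_(i <- r | P i) s i).
Proof.
move=> us; elim: r => [|i r IH].
  by rewrite big_nil; apply: asum_ext asum0 => n; rewrite big_nil.
rewrite big_cons; case: ifP => Pi.
  by apply: asum_ext (asumD (us _ Pi) IH) => n; rewrite big_cons Pi.
by apply: asum_ext IH => n; rewrite big_cons Pi.
Qed.

Section Reindex.
Variables (tau sigma : int -> int) (u : int -> R[i]) (s : R[i]).
Hypothesis tauK : cancel tau sigma.
Hypothesis supp : forall n, tau (sigma n) != n -> u n = 0.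

(** The section hypotheses say that tau is injective and that u vanishes outside its range, which
    consists of the n with tau (sigma n) = n. *)
Lemma asum_reindex : asum u s -> asum (u \o tau) s.
Proof.
have tauI := can_inj tauK.
move=> [[M uM] us]; split.
  by exists M => B uB; rewrite -(big_map tau predT (fun n => cabs (u n))) uM // map_inj_uniq.
move=> e e0; have [A hA] := us _ e0; exists (map sigma A) => B uB AB.
(* The image of B may miss elements of A, but only some outside the range of tau, so adding them
   does not change the sum. *)
pose C := map tau B ++ [seq n <- undup A | n \notin map tau B].
have -> : \sum_(n <- B) (u \o tau) n = \sum_(n <- C) u n.
  rewrite big_cat big_map /= [X in _ = _ + X]big1_seq ?addr0 // => n /andP[_].
  rewrite mem_filter mem_undup => /andP[nB nA]; apply: supp.
  by apply: contra nB => /eqP <-; apply: map_f; apply: AB; exact: map_f.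
apply: hA => [|n nA].
  rewrite cat_uniq map_inj_uniq // uB filter_uniq ?undup_uniq // andbT /= -all_predC.
  by apply/allP => n; rewrite mem_filter => /andP[].
rewrite mem_cat mem_filter mem_undup nA andbT.
by case: (n \in map tau B).
Qed.

Lemma asum_unindex : asum (u \o tau) s -> asum u s.
Proof.
(* The preimages under tau of those elements of B that lie in its range. *)
pose D B := map sigma [seq n <- B | tau (sigma n) == n].
have Duniq B : uniq B -> uniq (D B).
  move=> uB; rewrite map_inj_in_uniq ?filter_uniq // => x y.
  by rewrite !mem_filter => /andP[/eqP <- _] /andP[/eqP <- _]; rewrite !tauK => ->.
have Dsum (V : nmodType) (F : int -> V) B : (forall n, u n = 0 -> F n = 0) ->
    \sum_(n <- B) F n = \sum_(n <- D B) F (tau n).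
  move=> F0; rewrite /D big_map big_filter (bigID (fun n => tau (sigma n) == n)) /=.
  rewrite [X in _ + X]big1 ?addr0; first by apply: eq_bigr => n /eqP ->.
  by move=> n /supp/F0.
move=> [[M uM] us]; split.
  exists M => B uB; rewrite (Dsum _ (fun n => cabs (u n))) ?uM ?Duniq // => n ->.
  exact: cabs0.
move=> e e0; have [A hA] := us _ e0; exists (map tau A) => B uB AB.
rewrite (Dsum _ u) //; apply: hA; first exact: Duniq.
move=> n nA; apply/mapP; exists (tau n); last by rewrite tauK.
by rewrite mem_filter tauK eqxx AB // map_f.
Qed.

End Reindex.

End UnconditionalSums.

(** * Sums of roots of unity *)

Section RootsOfUnity.
Variable R : realType.

Lemma ratioC (x y : R) : (x / y)%:C = x%:C / y%:C :> R[i].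
Proof. by rewrite rmorphM fmorphV. Qed.

Lemma e2pi_real (x : R) : e2pi x%:C = cos (2 * pi * x) +i* sin (2 * pi * x).
Proof.
have -> : e2pi x%:C = cexp (Complex 0 (2 * pi * x)).
  by congr cexp; apply/eqP; rewrite eq_complex /=; apply/andP; split; apply/eqP; ring.
by rewrite /cexp /= expR0 mul1r.
Qed.

(** The real part is 1 - 2 sin(pi x)^2, and sin(pi x) > 0 on ]0, 1[. *)
Lemma e2pi_real_neq1 (x : R) : 0 < x < 1 -> e2pi x%:C != 1.
Proof.
move=> /andP[x0 x1]; rewrite e2pi_real eq_complex /= negb_and; apply/orP; left.
have -> : 2 * pi * x = (pi * x) *+ 2 by ring.
rewrite cos_mulr2n cos2sin2.
have : 0 < sin (pi * x).
  by apply: sin_gt0_pi; rewrite mulr_gt0 ?pi_gt0 //= gtr_pMr ?pi_gt0.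
move: (sin _) => t t0; have : 0 < t ^+ 2 by rewrite exprn_gt0.
by move=> ?; rewrite lt_eqF //; lra.
Qed.

(** After reduction of l modulo d the argument lies in [0, 1[, where e takes the value 1 only at
    0. *)
Lemma e2pi_ratio (l : int) (d : nat) : (0 < d)%N ->
  e2pi (l%:~R / d%:R : R[i]) ^+ d = 1 /\
  (e2pi (l%:~R / d%:R : R[i]) == 1) = (d%:Z %| l)%Z.
Proof.
move=> d0; have dC0 : d%:R != 0 :> R[i] by rewrite pnatr_eq0 -lt0n.
split; first by rewrite -e2piMn mulrC divfK // e2pi_int.
have [/dvdzP[q ->]|dl] := boolP (d%:Z %| l)%Z.
  by rewrite rmorphM /= mulfK // e2pi_int eqxx.
have -> : e2pi (l%:~R / d%:R : R[i]) = e2pi ((l %% d%:Z)%Z%:~R / d%:R).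
  rewrite {1}(divz_eq l d%:Z) rmorphD rmorphM /= mulrDl mulfK // e2piD e2pi_int.
  by rewrite mul1r.
apply/negbTE; have -> : (l %% d%:Z)%Z%:~R / d%:R = ((l %% d%:Z)%Z%:~R / d%:R : R)%:C.
  by rewrite ratioC -intCE -natCE.
have dR : 0 < d%:R :> R by rewrite ltr0n.
have dZ : d%:Z != 0 by lia.
have lo : 0 < (l %% d%:Z)%Z.
  rewrite lt_neqAle modz_ge0 // andbT.
  by apply: contra dl => /eqP/esym/dvdz_mod0P.
have hi : (l %% d%:Z)%Z < d%:Z by apply: ltz_pmod; lia.
apply: e2pi_real_neq1; rewrite divr_gt0 ?ltr0z //= ltr_pdivrMr // mul1r.
by rewrite -[d%:R]/(d%:Z%:~R) ltr_int.
Qed.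

(** A geometric sum of a d-th root of unity w vanishes unless w = 1. *)
Lemma sum_e2pi (l : int) (d : nat) : (0 < d)%N ->
  \sum_(0 <= b < d) e2pi (b%:R * (l%:~R / d%:R)) = (if (d%:Z %| l)%Z then d%:R else 0) :> R[i].
Proof.
move=> d0; have [wd w1] := e2pi_ratio l d0.
under eq_bigr do rewrite e2piMn.
rewrite -w1; move: (e2pi _) wd {w1} => w wd; case: eqP => [->|/eqP w1].
  under eq_bigr do rewrite expr1n.
  by rewrite sumr_const_nat subn0.
have : (w - 1) * (\sum_(0 <= b < d) w ^+ b) = 0.
  by rewrite big_mkord -subrX1 wd subrr.
by move=> /eqP; rewrite mulf_eq0 subr_eq0 (negPf w1) => /eqP.
Qed.

End RootsOfUnity.

(** * Fourier coefficients under the Hecke operator *)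

Section Fourier.
Variable R : realType.
Implicit Types (c : int -> R[i]) (z : R[i]) (f : R[i] -> R[i]).

(** The Whittaker factor depends on |be| y and the sign of be, so al moves into the frequency; sqrt
    al corrects the normalisation by the square root of the frequency. *)
Lemma fourier_term_scale_shift (k : nat) (r be al x : R) z : 0 < al ->
  fourier_term k r be (scale_shift al x z) =
  (Num.sqrt al)%:C * e2pi (be * x)%:C * fourier_term k r (be * al) z.
Proof.
case: z => s t al0; rewrite scale_shiftE /fourier_term /=.
rewrite normrM sgrM (gtr0_norm al0) (gtr0_sg al0) mulr1.
have -> : 4 * pi * `|be| * (al * t) = 4 * pi * (`|be| * al) * t by ring.
rewrite sqrtrM //.
have -> : be * (al * s + x) = be * al * s + be * x by ring.
rewrite [(be * al * s + _)%:C]rmorphD e2piD [(Num.sqrt _ * Num.sqrt _)%:C]rmorphM invfM /=.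
have al1 : (Num.sqrt al)%:C != 0 :> R[i].
  by rewrite (_ : 0 = 0%:C) // (inj_eq (@complexI R)) gt_eqF // sqrtr_gt0.
move: (whittakerW _ _ _) (Num.sqrt al)%:C al1 ((Num.sqrt `|be|)%:C^-1) => W u u0 b.
rewrite [RHS](_ : _ = u / u * (W * b * (e2pi (be * al * s)%:C * e2pi (be * x)%:C))); last by ring.
by rewrite divff // mul1r.
Qed.

Variables (kap : int) (k m : nat) (r : R).
Hypotheses (m0 : (0 < m)%N) (km : (12 %| kap * (m%:Z + 1))%Z).

(** Common form of [hecke_d], for kap = k, and [hecke_b], for kap = - k. *)
Definition hecke_coeff c (n : int) : R[i] :=
  \sum_(1 <= a < m.+1 | (a%:Z %| gcdz m%:Z (n - (kap * (m%:Z + 1) %/ 12)%Z))%Z)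
    zeta12 R ^ (3 * (kap * (a%:Z - 1))) *
    c ((12 * m%:Z * n - kap * (m%:Z + a%:Z ^+ 2)) %/ (12 * a%:Z ^+ 2))%Z.

Let basis (be : R) n := fourier_term k r (n%:~R + be).
Let alpha : R := kap%:~R / 12.

Section OneDivisor.
Variables (a d : nat) (z : R[i]) (c : int -> R[i]).
Hypotheses (ad : (a * d = m)%N).

Let a0 : (0 < a)%N. Proof. by rewrite lt0n; apply: contraTneq m0 => a0; rewrite -ad a0. Qed.
Let d0 : (0 < d)%N. Proof. by rewrite lt0n; apply: contraTneq m0 => d0; rewrite -ad d0 muln0. Qed.

Let aR : 0 < a%:R :> R. Proof. by rewrite ltr0n. Qed.
Let dR : 0 < d%:R :> R. Proof. by rewrite ltr0n. Qed.

(** The sum over b keeps the n congruent to c0 modulo d, and s0 below is the corresponding class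
    modulo a after the operator. Both quotients are exact. *)
Let c0 : int := (kap * (d%:Z ^+ 2 - 1) %/ 12)%Z.
Let s0 : int := (kap * (m%:Z + 1) %/ 12)%Z.

Let c0E : 12 * c0 = kap * (d%:Z ^+ 2 - 1).
Proof.
have [_ h] := @dvdz12_sum_sqr kap a d (eq_ind_r (fun m => is_true (12 %| kap * (m%:Z + 1))%Z) km ad).
by rewrite mulrC divzK.
Qed.

Let s0E : 12 * s0 = kap * (m%:Z + 1).
Proof. by rewrite mulrC divzK. Qed.

Let c0R : c0%:~R + alpha = kap%:~R * d%:R ^+ 2 / 12 :> R.
Proof.
have := congr1 (fun n : int => n%:~R : R) c0E.
rewrite !(rmorphM, rmorphB, rmorphXn, rmorph1) /= -[d%:Z%:~R]/(d%:R) /alpha => h.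
have -> : c0%:~R = (12%:~R * c0%:~R) / 12 :> R by field.
by rewrite h; field.
Qed.

Let s0R : s0%:~R - alpha = kap%:~R * m%:R / 12 :> R.
Proof.
have := congr1 (fun n : int => n%:~R : R) s0E.
rewrite !(rmorphM, rmorphD, rmorph1) /= -[m%:Z%:~R]/(m%:R) /alpha => h.
have -> : s0%:~R = (12%:~R * s0%:~R) / 12 :> R by field.
by rewrite h; field.
Qed.

Let rep (b : nat) := (a%:R * z + b%:R) / d%:R.

(** The only dependence on b is through a d-th root of unity to the power b, so the sum is d or
    0. *)
Lemma hecke_weight_sum (n : int) :
  \sum_(0 <= b < d) hecke_weight R kap m a b * (c n * basis alpha n (rep b)) =
  if (d%:Z %| n - c0)%Z then
    zeta12 R ^ (3 * (kap * (a%:Z - 1))) * (c n * fourier_term k r ((n%:~R + alpha) * (a%:R / d%:R)) z)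
  else 0.
Proof.
have mE : (m %/ a = d)%N by rewrite -ad mulKn.
have term b : hecke_weight R kap m a b * (c n * basis alpha n (rep b)) =
   (Num.sqrt m%:R)^-1%:C * (Num.sqrt (a%:R / d%:R))%:C *
   (zeta12 R ^ (3 * (kap * (a%:Z - 1))) * (c n * fourier_term k r ((n%:~R + alpha) * (a%:R / d%:R)) z)) *
   e2pi (b%:R * ((n - c0)%:~R / d%:R)).
  have -> : rep b = scale_shift (a%:R / d%:R) (b%:R / d%:R) z.
    rewrite /rep /scale_shift !ratioC -!natCE.
    by rewrite mulrDl mulrAC.
  rewrite /basis fourier_term_scale_shift ?divr_gt0 // /hecke_weight mE.
  have -> : kap * (3 * (a%:Z - 1) - b%:Z * d%:Z) =
     3 * (kap * (a%:Z - 1)) + (- (kap * b%:Z * d%:Z)) by ring.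
  rewrite zeta12D [in LHS](zeta12_e2pi R (- _)).
  (* Since c0 + alpha = kap d^2 / 12, the weight cancels the fractional shift: (n + alpha) / d - kap
     d / 12 = (n - c0) / d. *)
  have -> : e2pi (b%:R * ((n - c0)%:~R / d%:R)) =
     e2pi ((- (kap * b%:Z * d%:Z))%:~R / 12) * e2pi ((n%:~R + alpha) * (b%:R / d%:R))%:C :> R[i].
    rewrite -e2piD; congr e2pi.
    have -> : (- (kap * b%:Z * d%:Z))%:~R / 12 =
       ((- (kap%:~R * b%:R * d%:R) / 12 : R)%:C) :> R[i].
      by rewrite ratioC intCE (natCE _ 12) !rmorphN !rmorphM.
    have -> : b%:R * ((n - c0)%:~R / d%:R) = (b%:R * ((n - c0)%:~R / d%:R) : R)%:C :> R[i].
      by rewrite intCE !natCE -ratioC -rmorphM.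
    rewrite -rmorphD; congr (_%:C); rewrite rmorphB /=.
    have -> : c0%:~R = kap%:~R * d%:R ^+ 2 / 12 - alpha :> R by rewrite -c0R; ring.
    by field; rewrite gt_eqF.
  ring.
rewrite (eq_bigr _ (fun b _ => term b)) -mulr_sumr sum_e2pi //.
case: ifP => _; last by rewrite mulr0.
have sq : (Num.sqrt m%:R)^-1%:C * (Num.sqrt (a%:R / d%:R))%:C * d%:R = 1 :> R[i].
  rewrite natCE -!rmorphM /= -ad natrM sqrtrM // sqrtrM // sqrtrV //.
  have ha : Num.sqrt a%:R != 0 :> R by rewrite gt_eqF // sqrtr_gt0.
  have hd : Num.sqrt d%:R != 0 :> R by rewrite gt_eqF // sqrtr_gt0.
  rewrite -{3}(sqr_sqrtr (ltW dR)).
  by rewrite (_ : _ * _ = 1) //; field; rewrite ha hd.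
move: sq; move: ((Num.sqrt m%:R)^-1%:C) ((Num.sqrt (a%:R / d%:R))%:C) (zeta12 R ^ _) (c n * _) => x y w v sq.
by transitivity (x * y * d%:R * (w * v)); [ring|rewrite sq mul1r].
Qed.

Let target (n : int) : R[i] :=
  if (a%:Z %| n - s0)%Z then
    zeta12 R ^ (3 * (kap * (a%:Z - 1))) *
    (c ((12 * m%:Z * n - kap * (m%:Z + a%:Z ^+ 2)) %/ (12 * a%:Z ^+ 2))%Z * basis (- alpha) n z)
  else 0.

(** Both series are parametrised by an integer t: the source index is d t + c0 and the target index
    a t + s0. *)
Lemma asum_one_divisor s :
  asum (fun n => \sum_(0 <= b < d) hecke_weight R kap m a b * (c n * basis alpha n (rep b))) s ->
  asum target s.
Proof.
have aZ : a%:Z != 0 by lia.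
have dZ : d%:Z != 0 by lia.
move=> h.
have {}h := asum_ext hecke_weight_sum h.
have K1 : cancel (fun t => d%:Z * t + c0) (fun n => ((n - c0) %/ d%:Z)%Z).
  by move=> t; rewrite addrK mulKz.
have K2 : cancel (fun t => a%:Z * t + s0) (fun n => ((n - s0) %/ a%:Z)%Z).
  by move=> t; rewrite addrK mulKz.
have {}h := asum_reindex K1 _ h.
apply: (asum_unindex K2) => [n|].
  rewrite /target; case: ifP => // /dvdzP[q qE].
  by rewrite qE mulzK // mulrC -qE subrK eqxx.
apply: asum_ext (h _) => [t|n]; last first.
  case: ifP => // /dvdzP[q qE].
  by rewrite qE mulzK // mulrC -qE subrK eqxx.
rewrite /target /= !addrK !dvdz_mulr //.
(* Two checks at n = a t + s0: the index of c is d t + c0, and both frequencies equal a t + kap m /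
   12. *)
congr (_ * (c _ * fourier_term _ _ _ _)).
  have -> : 12 * m%:Z * (a%:Z * t + s0) - kap * (m%:Z + a%:Z ^+ 2) =
     (d%:Z * t + c0) * (12 * a%:Z ^+ 2).
    have mE : m%:Z = a%:Z * d%:Z by rewrite -PoszM ad.
    transitivity (12 * m%:Z * a%:Z * t + m%:Z * (12 * s0) - kap * (m%:Z + a%:Z ^+ 2)); first by ring.
    rewrite s0E; transitivity (12 * a%:Z ^+ 2 * d%:Z * t + a%:Z ^+ 2 * (12 * c0)); last by ring.
    by rewrite c0E mE; ring.
  by rewrite mulzK // mulf_neq0 // expf_neq0.
rewrite !rmorphD !rmorphM /= -!addrA c0R s0R -[d%:Z%:~R]/(d%:R) -[a%:Z%:~R]/(a%:R) -ad natrM.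
by field; rewrite gt_eqF.
Qed.

End OneDivisor.

(** The finite sum over a commutes with unconditional summation; the condition a | gcd(m, n - s0) is
    split into a | m, which bounds that sum, and a | n - s0, which stays in the terms. *)
Lemma hecke_fourier f c :
  fourier_expansion (basis alpha) c f ->
  fourier_expansion (basis (- alpha)) (hecke_coeff c) (hecke kap m f).
Proof.
move=> fc z zH; apply: asum_sums_to.
pose s0 := (kap * (m%:Z + 1) %/ 12)%Z.
have key : asum (fun n => \sum_(1 <= a < m.+1 | (a %| m)%N)
    (if (a%:Z %| n - s0)%Z then zeta12 R ^ (3 * (kap * (a%:Z - 1))) *
      (c ((12 * m%:Z * n - kap * (m%:Z + a%:Z ^+ 2)) %/ (12 * a%:Z ^+ 2))%Z * basis (- alpha) n z) else 0))
    (hecke kap m f z).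
  apply: asum_sum => a am.
  have ad : (a * (m %/ a) = m)%N by rewrite mulnC divnK.
  apply: (asum_one_divisor ad); apply: asum_sum => b _; apply: asumZ.
  apply: sums_to_asum; apply: fc.
  rewrite -mobius_hecke_rep; apply: uhp_mobius => //.
  by rewrite det_hecke_rep.
apply: asum_ext key => n; rewrite /hecke_coeff mulr_suml -big_mkcondr.
apply: eq_big => [a|a _]; last exact: mulrA.
by rewrite /s0 dvdz_gcd.
Qed.

End Fourier.

(** * Hecke operators on Maass waveforms *)

Section HeckeMaass.
Variable R : realType.
Implicit Types (f : R[i] -> R[i]) (z : R[i]).

Lemma cabs_expi (k : nat) (x : R) : cabs (cexp ('i * k%:R * x%:C)) = 1.
Proof.
have -> : 'i * k%:R * x%:C = Complex 0 (k%:R * x) :> R[i].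
  by rewrite natCE; apply/eqP; rewrite eq_complex /=; apply/andP; split; apply/eqP; ring.
rewrite /cexp cabsM /= expR0 /cabs !normc_def /=.
by rewrite cos2Dsin2 expr1n expr0n addr0 !sqrtr1 mulr1.
Qed.

Lemma automorphic_periodic (u : 'M[int]_2 -> R[i]) (k : nat) f :
  `|u Tmx| = 1 -> automorphic u k f -> forall z, uhp z -> cabs (f (z + 1)) = cabs (f z).
Proof.
move=> u1 fu z zH; have -> : z + 1 = mobius Tmx z.
  by rewrite /mobius /denom !mxE /= mul0r add0r mul1r divr1.
have u1' : cabs (u Tmx) = 1 by apply: (@complexI R); rewrite cabsC u1.
by rewrite fu ?detT // (cabsM _ (f z)) (cabsM (u Tmx)) u1' cabs_expi !mul1r.
Qed.

(** The conditions on a Maass waveform that are verified term by term; automorphy is established for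
    the whole Hecke sum instead. *)
Definition smooth_eigenfunction (k : nat) (la : R[i]) f : Prop :=
  [/\ classC 2 f, laplace_eigen k la f & square_integrable f].

Lemma classC_continuous n f : classC n f -> continuous_uhp f.
Proof. by case: n => [|n] []. Qed.

Lemma smooth_eigenfunctionD k la f g : smooth_eigenfunction k la f ->
  smooth_eigenfunction k la g -> smooth_eigenfunction k la (fun z => f z + g z).
Proof.
move=> [fC fL fI] [gC gL gI]; split.
- exact: classCD fC gC.
- exact: laplace_eigenD fC gC fL gL.
- exact: square_integrableD (classC_continuous fC) (classC_continuous gC) fI gI.
Qed.

Lemma smooth_eigenfunctionZ k la c f : smooth_eigenfunction k la f ->
  smooth_eigenfunction k la (fun z => c * f z).
Proof.
move=> [fC fL fI]; split.
- exact: classCZ fC.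
- exact: laplace_eigenZ fC fL.
- exact: square_integrableZ (classC_continuous fC) fI.
Qed.

Lemma smooth_eigenfunction_sum k la (I : Type) (r : seq I) (P : pred I) (F : I -> R[i] -> R[i]) f :
  smooth_eigenfunction k la f -> (forall i, P i -> smooth_eigenfunction k la (F i)) ->
  smooth_eigenfunction k la (fun z => \sum_(i <- r | P i) F i z).
Proof.
move=> fS FS; elim: r => [|i r IH].
  (* The empty sum is a multiple of f, which is the purpose of f in the hypotheses. *)
  have -> : (fun z => \sum_(i <- [::] | P i) F i z) = (fun z => 0 * f z).
    by apply/funext => z; rewrite big_nil mul0r.
  exact: smooth_eigenfunctionZ fS.
have [Pi|nPi] := boolP (P i).
  have -> : (fun z => \sum_(i <- i :: r | P i) F i z) = (fun z => F i z + \sum_(i <- r | P i) F i z).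
    by apply/funext => z; rewrite big_cons Pi.
  exact: smooth_eigenfunctionD (FS i Pi) IH.
have -> : (fun z => \sum_(i <- i :: r | P i) F i z) = (fun z => \sum_(i <- r | P i) F i z).
  by apply/funext => z; rewrite big_cons (negPf nPi).
exact: IH.
Qed.

Lemma hecke_maass (kap : int) (u u' : 'M[int]_2 -> R[i]) (k m : nat) (r : R) f :
  (0 < m)%N -> (12 %| kap * (m%:Z + 1))%Z -> multiplier kap u ->
  (forall g, \det g = 1 -> `|u g| = 1) -> (forall g, \det g = 1 -> u' g = (u g)^-1) ->
  maass_waveform u k r f -> maass_waveform u' k r (hecke kap m f).
Proof.
move=> m0 km umult unorm u'E [fC fu fL fI].
have fS : smooth_eigenfunction k (4^-1 + r ^+ 2)%:C f by split.
have fper := automorphic_periodic (unorm _ detT) fu.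
suff [hC hL hI] : smooth_eigenfunction k (4^-1 + r ^+ 2)%:C (hecke kap m f).
  by split => //; exact: hecke_automorphic m0 km umult u'E fu.
(* The bound 0 < a enters the summation condition, to have positive scaling factors. *)
have -> : hecke kap m f = fun z => \sum_(1 <= a < m.+1 | (0 < a)%N && (a %| m)%N)
    \sum_(0 <= b < (m %/ a)%N) (hecke_weight R kap m a b *
      f (scale_shift (a%:R / (m %/ a)%N%:R) (b%:R / (m %/ a)%N%:R) z)).
  apply/funext => z; rewrite /hecke big_nat_cond [RHS]big_nat_cond.
  apply: eq_big => [a|a _]; first by case: a.
  apply: eq_bigr => b _; congr (_ * f _).
  by rewrite /scale_shift !ratioC -!natCE mulrDl mulrAC.
apply: (smooth_eigenfunction_sum _ fS) => a /andP[a0 am].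
apply: (smooth_eigenfunction_sum _ fS) => b _; apply: smooth_eigenfunctionZ.
have al0 : 0 < a%:R / (m %/ a)%N%:R :> R.
  by rewrite divr_gt0 // ltr0n // divn_gt0 // dvdn_leq.
split.
- exact: classC_scale_shift al0 fC.
- exact: laplace_eigen_scale_shift al0 fC fL.
- exact: square_integrable_scale_shift al0 (classC_continuous fC) fper fI.
Qed.

Lemma Posz_sqr (a : nat) : (a ^ 2)%N%:Z = a%:Z ^+ 2.
Proof. by rewrite -mulnn PoszM expr2. Qed.

Section Coefficients.
Variables (k m : nat) (c : int -> R[i]).
Hypothesis km : (12 %| k%:Z * (m%:Z + 1))%Z.

Let shiftE : ((k * (m + 1)) %/ 12)%N%:Z = (k%:Z * (m%:Z + 1) %/ 12)%Z.
Proof. by rewrite -divz_nat PoszM PoszD. Qed.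

(** Floor division commutes with the sign here because it is exact. *)
Let shiftN : (- k%:Z * (m%:Z + 1) %/ 12)%Z = - (k%:Z * (m%:Z + 1) %/ 12)%Z.
Proof. by have /dvdzP[q qE] := km; rewrite mulNr qE -mulNr !mulzK. Qed.

Lemma hecke_dE : hecke_d k m c =1 hecke_coeff k%:Z m c.
Proof.
move=> n; rewrite /hecke_d /hecke_coeff shiftE.
apply: eq_bigr => a _; rewrite zeta12_3.
by rewrite !PoszM PoszD !Posz_sqr.
Qed.

(** For kap = - k the powers of i appear inverted; they agree with [chi] because they are 1 or -1
    for all a in the range. *)
Lemma hecke_bE : hecke_b k m c =1 hecke_coeff (- k%:Z) m c.
Proof.
move=> n; rewrite /hecke_b /hecke_coeff shiftE shiftN opprK.
apply: eq_bigr => a; rewrite dvdz_gcd => /andP[/dvdzP[d ad] _].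
have -> : chi R k a%:Z = zeta12 R ^ (3 * (- k%:Z * (a%:Z - 1))).
  rewrite /chi -zeta12_3; apply: zeta12_mod.
  (* k (a - 1) is even: either k is, or m = - 1 mod 4 and then a is odd *)
  suff : (2 %| k%:Z * (a%:Z - 1))%Z by lia.
  have [k' [|]kE] : exists k', k%:Z = 2 * k' \/ k%:Z = 2 * k' + 1.
  - by exists (k%:Z %/ 2)%Z; lia.
  - by rewrite kE -mulrA dvdz_mulr.
  have [a' [|]aE] : exists a', a%:Z = 2 * a' \/ a%:Z = 2 * a' + 1.
  - by exists (a%:Z %/ 2)%Z; lia.
  - have : (2 %| k%:Z * (m%:Z + 1))%Z by apply: dvdz_trans km.
    rewrite ad kE aE (_ : _ * _ = 2 * (2 * k' * d * a' + k' + d * a') + 1); last by ring.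
    lia.
  - by rewrite aE addrK mulrCA dvdz_mulr.
rewrite !PoszM PoszD !Posz_sqr; congr (_ * c (_ %/ _)%Z).
by rewrite mulNr opprK.
Qed.

End Coefficients.

Lemma fourier_expansion_eq (W W' : int -> R[i] -> R[i]) c c' f :
  W = W' -> c =1 c' -> fourier_expansion W c f -> fourier_expansion W' c' f.
Proof. by move=> -> /funext ->. Qed.

End HeckeMaass.

Theorem proposition4p4 (R : realType) (k : nat) (v : 'M[int]_2 -> R[i])
    (r : R) (m : nat)
    (k_range : (1 <= k <= 11)%N)
    (v_eta : eta_multiplier k v)
    (lambda_gt : 4^-1 < 4^-1 + r ^+ 2)
    (m_gt0 : (0 < m)%N)
    (km : ((k * m)%N%:Z = - k%:Z %[mod 12])%Z) :
  let vbar := fun g => (v g)^* in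
  exists T Tbar : (R[i] -> R[i]) -> (R[i] -> R[i]),
    [/\ hecke_operator m T /\ hecke_operator m Tbar,
        forall f, maass_waveform v k r f -> maass_waveform vbar k r (T f),
        forall g, maass_waveform vbar k r g -> maass_waveform v k r (Tbar g),
        forall f c, maass_waveform v k r f ->
          fourier_expansion (Wfun k r) c f ->
          fourier_expansion (Wstar k r) (hecke_d k m c) (T f) &
        forall g c', maass_waveform vbar k r g ->
          fourier_expansion (Wstar k r) c' g ->
          fourier_expansion (Wfun k r) (hecke_b k m c') (Tbar g)].
Proof.
have km12 : (12 %| k%:Z * (m%:Z + 1))%Z.
  by move/eqP: km; rewrite eqz_mod_dvd opprK PoszM mulrDr mulr1.
have kmN : (12 %| - k%:Z * (m%:Z + 1))%Z by rewrite mulNr; lia.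
have vnorm g : \det g = 1 -> `|v g| = 1 by move=> /v_eta[].
have vV g : \det g = 1 -> (v g)^* = (v g)^-1.
  by move=> g1; rewrite invC_norm vnorm // expr1n invr1 mul1r.
have WE : Wfun k r = fun n => fourier_term k r (n%:~R + k%:Z%:~R / 12) by [].
have WstarE : Wstar k r = fun n => fourier_term k r (n%:~R - k%:Z%:~R / 12) by [].
(* Changing the sign of kap exchanges the two Fourier bases. *)
have WNE : Wfun k r = fun n => fourier_term k r (n%:~R - (- k%:Z)%:~R / 12).
  by rewrite WE; apply/funext => n; rewrite rmorphN mulNr opprK.
have WstarNE : Wstar k r = fun n => fourier_term k r (n%:~R + (- k%:Z)%:~R / 12).
  by rewrite WstarE; apply/funext => n; rewrite rmorphN mulNr.
(* Both operators come from one construction, with kap = k and kap = - k. *)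
move=> vbar; exists (hecke k%:Z m), (hecke (- k%:Z) m); split.
- by split; exact: hecke_operator_hecke.
- move=> f; apply: hecke_maass => //; exact: eta_multiplierP.
- move=> g; apply: hecke_maass => //; first exact: eta_multiplier_conjP.
  + by move=> h h1; rewrite norm_conjC vnorm.
  + by move=> h h1; rewrite /vbar vV // invrK.
- move=> f c _ fc; apply: (fourier_expansion_eq (esym WstarE) (fun n => esym (hecke_dE k m c n))).
  exact: hecke_fourier.
- move=> g c _ gc; apply: (fourier_expansion_eq (esym WNE) (fun n => esym (hecke_bE c km12 n))).
  apply: hecke_fourier => //.
  by rewrite -WstarNE.
Qed.
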